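(* Let $\alpha\in[1,e/2]$ and let $B>0$ be a constant not depending on $\delta$. For each $\delta\in(0,1)$, let $\tau_\delta$ be the stopping time of the CTAS algorithm run with Chernoff stopping threshold $\beta(t,\delta)=\log(Bt^\alpha/\delta)$. Then \[ \limsup_{\delta\to0}\frac{\mathbb{E}_{\boldsymbol{\mu}\times\boldsymbol{c}}[J(\tau_\delta)]}{\log(1/\delta)}\le\alpha\,T^*(\boldsymbol{\mu}), \] where $T^*(\boldsymbol{\mu})^{-1}=\sup_{\boldsymbol{w}\in\Sigma_K}\inf_{\boldsymbol{\lambda}:a^*(\boldsymbol{\lambda})\neq a^*(\boldsymbol{\mu})}\sum_a\frac{w_a}{c_a}d(\mu_a,\lambda_a)$.
   Context: Setting: $K$ arms $\mathcal{A}=\{1,\dots,K\}$; arm $a$ has reward distribution $\nu_{\mu_a}$ in a one-parameter natural exponential family $\{h(x)\exp(\theta_\mu x-b(\theta_\mu))\}$ parametrized by the mean $\mu\in[0,1]$ ($b$ convex, twice differentiable), and cost distribution with mean $c_a$ supported in $[\ell,1]$, $\ell>0$; the best arm $a^*(\boldsymbol{\mu})=\arg\max_a\mu_a$ is unique. At round $t$ the algorithm pulls $A_t$ and observes independent reward $R_t\sim\nu_{\mu_{A_t}}$ and cost $C_t$ from arm $A_t$'s cost distribution. $d(\mu,\mu')$ is the KL divergence between $\nu_\mu$ and $\nu_{\mu'}$; $\boldsymbol\lambda$ in the infimum ranges over reward-mean vectors of the family with a unique best arm. $N_a(t)$ is the number of pulls of $a$ up to $t$, $\hat\mu_a(t),\hat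 c_a(t)$ the empirical mean reward and cost of arm $a$, $J(t)=\sum_{k\le t}C_k$. Define $\hat\mu_{a,b}(t)=\frac{N_a(t)\hat\mu_a(t)+N_b(t)\hat\mu_b(t)}{N_a(t)+N_b(t)}$, $Z_{a,b}(t)=N_a(t)d(\hat\mu_a(t),\hat\mu_{a,b}(t))+N_b(t)d(\hat\mu_b(t),\hat\mu_{a,b}(t))$, $Z(t)=\max_a\min_{b\neq a}Z_{a,b}(t)$. $\Sigma_K$ is the probability simplex; for reward means $\boldsymbol{\mu}'$ with unique best arm and positive cost means $\boldsymbol{c}'$, $\boldsymbol{w}^*(\boldsymbol{\mu}',\boldsymbol{c}')$ is the maximizer over $\boldsymbol{w}\in\Sigma_K$ of $\inf_{\boldsymbol{\lambda}:a^*(\boldsymbol{\lambda})\ne a^*(\boldsymbol{\mu}')}\sum_a\frac{w_a}{c'_a}d(\mu'_a,\lambda_a)$. CTAS algorithm: pull each arm once; then at each subsequent time $t$, let $\mathcal{U}_t=\{a:N_a(t)<\sqrt t\}$, $\hat{\boldsymbol{w}}^*(t)=\boldsymbol{w}^*(\hat{\boldsymbol{\mu}}(t),\hat{\boldsymbol{c}}(t))$; if $\mathcal{U}_t\ne\emptyset$ pull an arm in $\arg\min_aN_a(t)$, otherwise pull an arm in $\arg\max_a(J(t)\hat w^*_a(t)-\hat c_a(t)N_a(t))$; stop at the first $t$ with $Z(t)>\beta(t,\delta)$ and output $\arg\max_a\hat\mu_a(t)$. *)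

(* Defs.v *)
From HB Require Import structures.
From mathcomp Require Import all_boot all_order all_algebra.
From mathcomp Require Import all_classical all_reals all_analysis.
From mathcomp Require Import measurable_realfun.
Set Implicit Arguments. Unset Strict Implicit. Unset Printing Implicit Defensive.
Import Order.TTheory GRing.Theory Num.Theory.
Import numFieldNormedType.Exports.
Local Open Scope classical_set_scope.
Local Open Scope ring_scope.

Section Family.
Variables (R : realType) (rho : {measure set (measurableTypeR R) -> \bar R})
          (h : R -> R).

Definition ef_unnorm (t : R) (x : R) : R := h x * expR (t * x).
Definition ef_b (t : R) : R := ln (Rintegral rho setT (ef_unnorm t)).
Definition ef_Theta : set R :=
  [set t | rho.-integrable setT (fun x => (ef_unnorm t x)%:E)].
Definition ef_dens (t : R) (x : R) : R := h x * expR (t * x - ef_b t).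
Definition ef_nu (t : R) (A : set R) : \bar R :=
  (\int[rho]_(x in A) (ef_dens t x)%:E)%E.
Definition ef_mean (t : R) : R := Rintegral rho setT (fun x => x * ef_dens t x).
Definition ef_M : set R := [set ef_mean t | t in ef_Theta°].
Definition ef_theta (mu : R) : R := xget 0 [set t | ef_Theta° t /\ ef_mean t = mu].
Definition ef_KL (t t' : R) : R :=
  Rintegral rho setT (fun x => ef_dens t x * ln (ef_dens t x / ef_dens t' x)).
Definition ef_dKL (mu mu' : R) : R := ef_KL (ef_theta mu) (ef_theta mu').
(* d(mu, mu'): KL(nu_mu, nu_mu'); extended by continuity to the boundary of
   the mean space (needed for empirical means, e.g. Bernoulli), and d(x,x)=0 *)
Definition ef_d (x y : R) : R :=
  if x == y then 0
  else if x \in ef_M then ef_dKL x y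
  else lim ((fun x' => ef_dKL x' y) @ within ef_M (nbhs x)).
End Family.

Section Bandit.
Variables (R : realType) (K : nat).
Implicit Types (v w : 'I_K -> R).

Definition is_best v (a : 'I_K) : Prop := forall b, b != a -> v b < v a.

Definition simplex : set ('I_K -> R) :=
  [set w | (forall a, 0 <= w a) /\ \sum_a w a = 1].

Definition alt (M : set R) (mu' : 'I_K -> R) : set ('I_K -> R) :=
  [set lam | (forall a, M (lam a)) /\ (exists a, is_best lam a) /\
             (forall a, is_best mu' a -> ~ is_best lam a)].

Definition ctas_obj (M : set R) (d : R -> R -> R) (mu' c' w : 'I_K -> R) : R :=
  inf [set \sum_a w a / c' a * d (mu' a) (lam a) | lam in alt M mu'].

Definition Tstar (M : set R) (d : R -> R -> R) (mu c : 'I_K -> R) : R :=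
  (sup [set ctas_obj M d mu c w | w in simplex])^-1.

(* history = sequence of (arm pulled, reward observed, cost observed) *)
Definition hist_t := seq ('I_K * R * R).

Definition Npulls (hs : hist_t) (a : 'I_K) : nat :=
  count (fun e : 'I_K * R * R => e.1.1 == a) hs.
Definition Ssum (hs : hist_t) (a : 'I_K) : R :=
  \sum_(e <- hs | e.1.1 == a) e.1.2.
Definition Csum (hs : hist_t) (a : 'I_K) : R :=
  \sum_(e <- hs | e.1.1 == a) e.2.
Definition muhat (hs : hist_t) (a : 'I_K) : R := Ssum hs a / (Npulls hs a)%:R.
Definition chat (hs : hist_t) (a : 'I_K) : R := Csum hs a / (Npulls hs a)%:R.
Definition Jcost (hs : hist_t) : R := \sum_(e <- hs) e.2.

Definition Zab (d : R -> R -> R) (hs : hist_t) (a b : 'I_K) : R :=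
  let Na := (Npulls hs a)%:R in let Nb := (Npulls hs b)%:R in
  let mab := (Na * muhat hs a + Nb * muhat hs b) / (Na + Nb) in
  Na * d (muhat hs a) mab + Nb * d (muhat hs b) mab.

Definition Zstat (d : R -> R -> R) (hs : hist_t) : \bar R :=
  (\big[Order.max/-oo]_a \big[Order.min/+oo]_(b | b != a) (Zab d hs a b)%:E)%E.

(* next arm of CTAS given the history; [sel] is the tie-breaking rule,
   [wstar] the map (mu', c') |-> w*(mu', c') *)
Definition ctas_next (wstar : ('I_K -> R) -> ('I_K -> R) -> ('I_K -> R))
    (sel : hist_t -> {set 'I_K} -> 'I_K) (hs : hist_t) : 'I_K :=
  match [pick a | Npulls hs a == 0%N] with
  | Some a => a
  | None =>
    let t := size hs in
    if [exists a, (Npulls hs a)%:R < Num.sqrt (t%:R : R)] then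
      sel hs (finset (fun a => [forall b, (Npulls hs a <= Npulls hs b)%N]))
    else
      let w := wstar (muhat hs) (chat hs) in
      let score a := Jcost hs * w a - chat hs a * (Npulls hs a)%:R in
      sel hs (finset (fun a => [forall b, score b <= score a]))
  end.

(* history after t rounds, arm a receiving its n-th reward X a n and cost C a n
   (n counted from 0): the "stack of rewards" model *)
Fixpoint ctas_hist {T : Type} wstar sel (X C : 'I_K -> nat -> T -> R)
    (t : nat) (om : T) : hist_t :=
  match t with
  | 0 => [::]
  | t'.+1 =>
    let hs := ctas_hist wstar sel X C t' om in
    let a := ctas_next wstar sel hs in
    rcons hs (a, X a (Npulls hs a) om, C a (Npulls hs a) om)
  end.

Definition beta (B alpha : R) (t : nat) (delta : R) : R :=
  ln (B * (t%:R `^ alpha) / delta).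

Definition stops {T : Type} d wstar sel X C B alpha delta (om : T) : pred nat :=
  fun t => (K <= t)%N &&
    ((beta B alpha t delta)%:E < Zstat d (ctas_hist wstar sel X C t om))%E.

Definition J_tau {T : Type} d wstar sel X C B alpha delta (om : T) : \bar R :=
  match pselect (exists t, stops d wstar sel X C B alpha delta om t) with
  | left ex => (Jcost (ctas_hist wstar sel X C (ex_minn ex) om))%:E
  | right _ => +oo%E
  end.
End Bandit.

Definition mutually_independent {d} {T : measurableType d} {R : realType}
  (P : probability T R) {I : eqType} (F : I -> T -> R) : Prop :=
  forall (s : seq I), uniq s ->
  forall (A : I -> set R), (forall i, measurable (A i)) ->
  P (\bigcap_(i in [set` s]) (F i @^-1` A i)) =
  (\prod_(i <- s) P (F i @^-1` A i))%E.

Definition cost_mean {R : realType} {K : nat}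
  (kappa : 'I_K -> probability (measurableTypeR R) R) (a : 'I_K) : R :=
  Rintegral (kappa a) setT (fun x => x).

(* Main.v *)
(* Along a natural exponential family the divergence is a Bregman divergence in the mean parametrization, so the infimum over alternatives is the minimum over [b] of the transportation costs of the best arm [a0] and [b], and [Z(t)] is this objective at the empirical means with the weights [N_a(t) chat_a(t)].
The maximizer [w*] is unique, and by compactness of the simplex it varies continuously at the true parameters. Forced exploration gives every arm at least about [sqrt t] pulls, so outside a deviation event for the empirical means after some time [n], tracking drives [chat_a(t) N_a(t) / J(t)] to [w*_a], and [Z(t) >= r J(t)] for every fixed [r < V = 1 / T*] once [t] exceeds a constant multiple of [n^2]. As [t <= J(t) / ell] makes the term [alpha log t] of the threshold negligible, [J(tau) <= log(1/delta) / r + D (1 + n^2)].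
Chernoff bounds make the deviation probabilities of empirical means of [n] samples decay geometrically in [n], so the last deviation time has a finite second moment and [E J(tau) <= log(1/delta) / r + D'] with [D'] independent of [delta]; finally let [r] tend to [V]. This gives the bound without the factor [alpha >= 1]. *)

Require Import Defs.
From HB Require Import structures.
From mathcomp Require Import all_boot all_order all_algebra.
From mathcomp Require Import all_classical all_reals all_analysis.
From mathcomp Require Import measurable_realfun.
From mathcomp Require Import perm ring lra.
Import Order.TTheory GRing.Theory Num.Theory.
Import numFieldNormedType.Exports.
Local Open Scope classical_set_scope.
Local Open Scope ring_scope.

Set Implicit Arguments. Unset Strict Implicit. Unset Printing Implicit Defensive.

(** The only analytic input from the family is the strict tangent inequality
    [(s - t) m(t) < b(s) - b(t)]. It makes the mean map strictly increasing, the divergence positive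
    and the Chernoff exponents negative, and it is obtained without differentiating [b]. The record
    below keeps what the bandit argument needs: in mean coordinates [th] is the natural parameter
    and [bb] is the log-partition function composed with [th]. The obstacle is adaptivity, since the
    number of pulls of an arm depends on the rewards. Because the samples sit in stacks, every
    empirical mean is the average of a prefix of a stack. The good event therefore speaks of
    averages of exactly [n] samples, whatever the algorithm does, and the analysis of a path on that
    event is deterministic. All randomness enters through one index, the last bad prefix length [n].
    Forced exploration secures [n] pulls of every arm only after about [n ^ 2] rounds, which is why
    the second moment of that index is needed. *)

Record bregman_divergence (R : realType) (M : set R) (d : R -> R -> R)
    (th bb : R -> R) : Prop := BregmanDivergence {
  bd_open : forall x, M x -> nbhs x M;
  bd_itv : is_interval M;
  bd_E : forall x y, M x -> M y -> d x y = bb y - bb x - (th y - th x) * x;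
  bd_gt0 : forall x y, M x -> M y -> x != y -> 0 < d x y;
  bd_th : forall x, M x -> {for x, continuous th};
  bd_bb : forall x, M x -> {for x, continuous bb} }.

(** * Exponential families *)

Section ExponentialFamily.
Variables (R : realType) (rho : {measure set (measurableTypeR R) -> \bar R}).
Variable h : R -> R.
Hypothesis h_ge0 : forall x, 0 <= h x.
Hypothesis h_meas : measurable_fun setT h.

Local Notation u := (ef_unnorm h).
Local Notation Theta := (ef_Theta rho h).
Local Notation b := (ef_b rho h).
Local Notation m := (ef_mean rho h).
Local Notation M := (ef_M rho h).

Definition ef_mass (t : R) : R := Rintegral rho setT (u t).
Definition ef_moment (t : R) : R := Rintegral rho setT (fun x => x * u t x).
Local Notation I := ef_mass.
Local Notation J := ef_moment.

Lemma ef_unnorm_ge0 t x : 0 <= u t x.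
Proof. by rewrite mulr_ge0 ?h_ge0 ?expR_ge0. Qed.

Lemma measurable_ef_unnorm t : measurable_fun setT (u t).
Proof.
apply: measurable_funM => //; apply: measurableT_comp => //.
Qed.

(** Monotonicity in the parameter, with direction given by the sign of [x]: a bound uniform over a
    window of parameters, as dominated convergence requires. *)
Lemma expR_le_expR2 (r t0 t x : R) : `|t - t0| <= r ->
  expR (t * x) <= expR ((t0 + r) * x) + expR ((t0 - r) * x).
Proof.
move=> ht; have /andP[h1 h2] : t0 - r <= t <= t0 + r.
  by move: ht; rewrite ler_norml => /andP[? ?]; apply/andP; split; lra.
case: (lerP 0 x) => x0.
  apply: (@le_trans _ _ (expR ((t0 + r) * x))); last by rewrite lerDl expR_ge0.
  by rewrite ler_expR ler_wpM2r.
apply: (@le_trans _ _ (expR ((t0 - r) * x))); last by rewrite lerDr expR_ge0.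
by rewrite ler_expR ler_wnM2r // ltW.
Qed.

Lemma ef_unnorm_le (r t0 t x : R) : `|t - t0| <= r ->
  u t x <= u (t0 + r) x + u (t0 - r) x.
Proof. by move=> ht; rewrite /ef_unnorm -mulrDr ler_wpM2l ?h_ge0 ?expR_le_expR2. Qed.

(** The factor [|x|] is at most [exp(r |x|) / r], which only shifts the parameter by [r]; hence the
    window of radius [2 r]. *)
Lemma ef_unnorm_moment_le (r t0 t x : R) : 0 < r -> `|t - t0| <= r ->
  `|x * u t x| <= r^-1 * (u (t0 + 2 * r) x + u (t0 - 2 * r) x).
Proof.
move=> r0 ht; rewrite normrM (ger0_norm (ef_unnorm_ge0 _ _)).
have hx : `|x| <= r^-1 * expR (r * `|x|).
  rewrite ler_pdivlMl //; apply: le_trans (expR_ge1Dx _); lra.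
have key : expR (r * `|x|) * expR (t * x) <=
    expR ((t0 + 2 * r) * x) + expR ((t0 - 2 * r) * x).
  rewrite -expRD; case: (ger0P x) => x0.
    rewrite -mulrDl; apply: expR_le_expR2.
    by move: ht; rewrite !ler_norml => /andP[? ?]; apply/andP; split; lra.
  rewrite mulrN -mulNr -mulrDl; apply: expR_le_expR2.
  by move: ht; rewrite !ler_norml => /andP[? ?]; apply/andP; split; lra.
apply: (@le_trans _ _ (r^-1 * expR (r * `|x|) * u t x)).
  by rewrite ler_wpM2r ?ef_unnorm_ge0.
rewrite -mulrA ler_pM2l ?invr_gt0 // /ef_unnorm -mulrDr mulrCA.
by rewrite ler_wpM2l ?h_ge0.
Qed.

Lemma Theta_interior t : Theta° t ->
  exists2 r, 0 < r & forall s, `|s - t| <= 2 * r -> Theta s.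
Proof.
rewrite /interior/= => /nbhs_ballP[e /= e0 he].
exists (e / 4); first by rewrite divr_gt0.
by move=> s hs; apply: he; rewrite /ball/= distrC (le_lt_trans hs)//; lra.
Qed.

Lemma Theta_convex t1 t2 t : Theta t1 -> Theta t2 -> t1 <= t <= t2 -> Theta t.
Proof.
move=> h1 h2 /andP[t1t tt2].
have /(le_integrable _ _) := integrableD measurableT h2 h1; apply => //.
  by apply/measurable_EFinP; exact: measurable_ef_unnorm.
move=> x _; rewrite -EFinD /= lee_fin.
rewrite !ger0_norm ?addr_ge0 ?ef_unnorm_ge0 //.
have := @ef_unnorm_le ((t2 - t1) / 2) ((t1 + t2) / 2) t x.
have -> : (t1 + t2) / 2 + (t2 - t1) / 2 = t2 by lra.
have -> : (t1 + t2) / 2 - (t2 - t1) / 2 = t1 by lra.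
by apply; rewrite ler_norml; apply/andP; split; lra.
Qed.

Lemma Theta_interior_convex t1 t2 t :
  Theta° t1 -> Theta° t2 -> t1 <= t <= t2 -> Theta° t.
Proof.
move=> h1 h2 /andP[]; rewrite le_eqVlt => /predU1P[<-//|t1t].
rewrite le_eqVlt => /predU1P[->//|tt2].
have : t \in `]t1, t2[ by rewrite in_itv/= t1t tt2.
move=> /near_in_itvoo; rewrite /interior/=; apply: filterS => s.
rewrite in_itv/= => /andP[/ltW ? /ltW ?].
by apply: (@Theta_convex t1 t2) => //; [exact: interior_subset|exact: interior_subset|apply/andP].
Qed.

Lemma integrable_moment t : Theta° t ->
  rho.-integrable setT (fun x => (x * u t x)%:E).
Proof.
move=> /Theta_interior[r r0 hr].
have hp : Theta (t + 2 * r) by apply: hr; rewrite addrAC subrr add0r ger0_norm //; lra.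
have hm : Theta (t - 2 * r).
  by apply: hr; rewrite addrAC subrr add0r normrN ger0_norm //; lra.
have := integrableZl measurableT r^-1 (integrableD measurableT hp hm).
move=> /(le_integrable measurableT _ _); apply => //.
  apply/measurable_EFinP; apply: measurable_funM => //; exact: measurable_ef_unnorm.
move=> x _; rewrite -EFinD -EFinM /= lee_fin.
rewrite (le_trans (@ef_unnorm_moment_le r t t x r0 _)) ?subrr ?normr0 ?ler_norm //.
exact: ltW.
Qed.

Lemma ef_mass_continuous t : Theta° t -> {for t, continuous I}.
Proof.
move=> /Theta_interior[r r0 hr].
have hp : Theta (t + 2 * r) by apply: hr; rewrite addrAC subrr add0r ger0_norm //; lra.
have hm : Theta (t - 2 * r).
  by apply: hr; rewrite addrAC subrr add0r normrN ger0_norm //; lra.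
have dist x : `]t - r, t + r[%classic x -> `|x - t| <= 2 * r.
  by rewrite /= in_itv/= ler_norml => /andP[? ?]; apply/andP; split; lra.
have := @continuity_under_integral R _ _ rho u setT measurableT (t - r) (t + r) _ _
  (fun x => u (t + 2 * r) x + u (t - 2 * r) x) _ _ t.
apply.
- by move=> x /dist /hr.
- apply: aeW => y _ s _; apply: cvgM; first exact: cvg_cst.
  apply: continuous_comp; last exact: continuous_expR.
  by apply: cvgM; [exact: cvg_id|exact: cvg_cst].
- exact: (integrableD measurableT hp hm).
- move=> x /dist xt; apply: aeW => y _.
  rewrite ger0_norm ?ef_unnorm_ge0 //; exact: ef_unnorm_le.
- by rewrite inE/= in_itv/=; apply/andP; split; lra.
Qed.

Lemma ef_moment_continuous t : Theta° t -> {for t, continuous J}.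
Proof.
move=> tT; have [r r0 hr] := Theta_interior tT.
have hp : Theta (t + 2 * r) by apply: hr; rewrite addrAC subrr add0r ger0_norm //; lra.
have hm : Theta (t - 2 * r).
  by apply: hr; rewrite addrAC subrr add0r normrN ger0_norm //; lra.
have dist x : `]t - r, t + r[%classic x -> `|x - t| <= r.
  by rewrite /= in_itv/= ler_norml => /andP[? ?]; apply/andP; split; lra.
have mJ s : measurable_fun setT (fun x : R => x * u s x).
  apply: measurable_funM => //; exact: measurable_ef_unnorm.
have dom_int := integrableZl measurableT r^-1 (integrableD measurableT hp hm).
have := @continuity_under_integral R _ _ rho (fun s x => x * u s x) setT measurableT
  (t - r) (t + r) _ _
  (fun x => r^-1 * (u (t + 2 * r) x + u (t - 2 * r) x)) _ _ t.
apply.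
- move=> s /dist st.
  move: (dom_int) => /(le_integrable measurableT _ _); apply => //.
    by apply/measurable_EFinP; exact: mJ.
  move=> x _; rewrite -EFinD -EFinM /= lee_fin.
  by rewrite (le_trans (@ef_unnorm_moment_le r t s x r0 st)) // ler_norm.
- apply: aeW => y _ s _; apply: cvgM; first exact: cvg_cst.
  apply: cvgM; first exact: cvg_cst.
  apply: continuous_comp; last exact: continuous_expR.
  by apply: cvgM; [exact: cvg_id|exact: cvg_cst].
- exact: dom_int.
- move=> x /dist xt; apply: aeW => y _.
  exact: ef_unnorm_moment_le.
- by rewrite inE/= in_itv/=; apply/andP; split; lra.
Qed.

Lemma ef_mass_ge0 t : 0 <= I t.
Proof. by apply: Rintegral_ge0 => x _; exact: ef_unnorm_ge0. Qed.

Lemma aeS (P Q : R -> Prop) : (forall x, P x -> Q x) ->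
  {ae rho, forall x, P x} -> {ae rho, forall x, Q x}.
Proof.
move=> PQ Pae. have F := ae_filter_ringOfSetsType rho.
  exact: (@filterS _ _ F _ _ PQ Pae).
Qed.

Lemma eq_Rintegral_ae (f g : R -> R) : measurable_fun setT f -> measurable_fun setT g ->
  {ae rho, forall x, f x = g x} -> Rintegral rho setT f = Rintegral rho setT g.
Proof.
move=> mf mg fg; congr fine; apply: ae_eq_integral => //; try exact/measurable_EFinP.
by apply: aeS fg => x fgx _; congr EFin.
Qed.

Lemma Rintegral_eq0_ae (f : R -> R) : (forall x, 0 <= f x) ->
  rho.-integrable setT (EFin \o f) -> Rintegral rho setT f = 0 ->
  {ae rho, forall x, f x = 0}.
Proof.
move=> f0 intf If.
have mf := measurable_int _ intf.
have : (\int[rho]_x `|(EFin \o f) x| = 0)%E.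
  under eq_integral do rewrite /= ger0_norm //.
  rewrite -[LHS]fineK; last exact: integrable_fin_num.
  by congr EFin.
move=> /(ae_eq_integral_abs _ measurableT mf); apply: aeS => x /(_ Logic.I) /=.
by case.
Qed.

Section Nondegenerate.
Hypothesis M_nondeg : exists x y, [/\ M x, M y & x != y].

(** A carrier vanishing almost everywhere would make every mean equal to 0, against the two distinct
    means. *)
Lemma not_ae_h0 : ~ {ae rho, forall x, h x = 0}.
Proof.
move=> h0; have mean0 t : m t = 0.
  rewrite /ef_mean (@eq_Rintegral_ae _ (cst 0)) //.
  - by rewrite /Rintegral integral0_eq.
  - apply: measurable_funM => //; apply: measurable_funM => //.
    apply: measurableT_comp => //; exact: measurable_funB.
  - by apply: aeS h0 => x hx; rewrite /ef_dens hx mul0r mulr0.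
by have [x [y [[t _ <-] [s _ <-]]]] := M_nondeg; rewrite !mean0 eqxx.
Qed.

Lemma ef_mass_gt0 t : Theta t -> 0 < I t.
Proof.
move=> tT; rewrite lt_neqAle ef_mass_ge0 andbT eq_sym; apply/eqP => It.
apply: not_ae_h0.
have := Rintegral_eq0_ae (@ef_unnorm_ge0 t) tT It; apply: aeS => x /eqP.
by rewrite mulf_eq0 (gt_eqF (expR_gt0 _)) orbF => /eqP.
Qed.

Lemma ef_densE t x : Theta t -> ef_dens rho h t x = u t x / I t.
Proof.
move=> tT; rewrite /ef_dens expRD mulrA expRN lnK // posrE.
exact: ef_mass_gt0.
Qed.

Lemma ef_meanE t : Theta° t -> m t = J t / I t.
Proof.
move=> tT; have tT' := interior_subset tT.
rewrite /ef_mean; under eq_Rintegral do rewrite (ef_densE _ tT') mulrA.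
by rewrite RintegralZr //; exact: integrable_moment.
Qed.

(** Were the weighted base measure concentrated at [c], every member of the family would have mean
    [c]. *)
Lemma not_ae_cst c : ~ {ae rho, forall x, h x * (x - c) = 0}.
Proof.
move=> hc; have meanc t : Theta° t -> m t = c.
  move=> tT; have It := ef_mass_gt0 (interior_subset tT).
  apply: (mulIf (lt0r_neq0 It)) => //; rewrite ef_meanE // divfK ?gt_eqF //.
  rewrite -RintegralZl //; last exact: (interior_subset tT).
  apply: eq_Rintegral_ae.
  - apply: measurable_funM => //; exact: measurable_ef_unnorm.
  - apply: measurable_funM => //; exact: measurable_ef_unnorm.
  - apply: aeS hc => x; rewrite /ef_unnorm => /(congr1 (fun z => z * expR (t * x))).
    rewrite mul0r => e; apply/eqP; rewrite -subr_eq0; apply/eqP; rewrite -[RHS]e; ring.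
by have [x [y [[t tT <-] [s sT <-]]]] := M_nondeg; rewrite !meanc ?eqxx.
Qed.

(* Integrate [exp v >= 1 + v] at [v = (s - t) (x - m t)] against the density of parameter [t]; equality forces the law to be a point mass. *)
Lemma ef_mass_gt t s : Theta° t -> Theta s -> s != t ->
  I t * expR ((s - t) * m t) < I s.
Proof.
move=> tT sT st; have tT' := interior_subset tT.
set c := m t; pose e := expR ((s - t) * c).
pose g x := u s x - e * ((1 - (s - t) * c) * u t x + (s - t) * (x * u t x)).
have It := ef_mass_gt0 tT'.
have int1 : rho.-integrable setT (fun x => ((1 - (s - t) * c) * u t x)%:E).
  exact: (integrableZl measurableT (1 - (s - t) * c) tT').
have int2 : rho.-integrable setT (fun x => ((s - t) * (x * u t x))%:E).
  exact: (integrableZl measurableT (s - t) (integrable_moment tT)).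
have int3 : rho.-integrable setT
    (fun x => (e * ((1 - (s - t) * c) * u t x + (s - t) * (x * u t x)))%:E).
  exact: (integrableZl measurableT e (integrableD measurableT int1 int2)).
have intg : rho.-integrable setT (EFin \o g).
  exact: (integrableB measurableT sT int3).
have gE x : g x = u t x * e * (expR ((s - t) * (x - c)) - (1 + (s - t) * (x - c))).
  have usE : u s x = u t x * e * expR ((s - t) * (x - c)).
    by rewrite /ef_unnorm -!mulrA -!expRD; congr (_ * expR _); ring.
  by rewrite /g usE; ring.
have g_ge0 x : 0 <= g x.
  by rewrite gE !mulr_ge0 ?ef_unnorm_ge0 ?expR_ge0 // subr_ge0 expR_ge1Dx.
have Ig : Rintegral rho setT g = I s - I t * e.
  rewrite /g RintegralB // RintegralZl //; last exact: (integrableD measurableT int1 int2).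
  rewrite RintegralD // !RintegralZl //; last exact: integrable_moment.
  have Jt : J t = c * I t by rewrite /c ef_meanE // divfK ?gt_eqF.
  change (I s - e * ((1 - (s - t) * c) * I t + (s - t) * J t) = I s - I t * e).
  by rewrite Jt; move: (I s) (I t) (c) (e) => ? ? ? ?; ring.
rewrite -subr_gt0 -Ig.
have : 0 <= Rintegral rho setT g by apply: Rintegral_ge0 => x _; exact: g_ge0.
rewrite le_eqVlt => /predU1P[/esym g0|//]; exfalso.
apply: (@not_ae_cst c).
have := Rintegral_eq0_ae g_ge0 intg g0; apply: aeS => x /eqP.
rewrite gE !mulf_eq0 !(gt_eqF (expR_gt0 _)) !orbF => /orP[/eqP ->|].
  by rewrite mul0r.
rewrite subr_eq0 => /eqP ee; have [->|xc] := eqVneq x c; first by rewrite subrr mulr0.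
have := @expR_gt1Dx _ ((s - t) * (x - c)); rewrite ee ltxx mulf_neq0 ?subr_eq0 //.
by move=> /(_ isT).
Qed.

(** Logarithm of [ef_mass_gt]: strict convexity of [b], with [m t] as slope at [t]. *)
Lemma ef_b_gt t s : Theta° t -> Theta s -> s != t -> (s - t) * m t < b s - b t.
Proof.
move=> tT sT st; have It := ef_mass_gt0 (interior_subset tT).
have Is := ef_mass_gt0 sT.
have bI r : 0 < I r -> expR (b r) = I r by move=> Ir; exact: lnK.
have bst : expR (b s - b t) = I s / I t.
  by rewrite -(bI _ Is) -(bI _ It); exact: expRB.
rewrite -ltr_expR bst (ltr_pdivlMr _ _ It) mulrC.
exact: ef_mass_gt.
Qed.

End Nondegenerate.
End ExponentialFamily.

(** * Mean coordinates for a log-partition function satisfying the strict tangent inequality *)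

Section LegendreFamily.
Variables (R : realType) (O : set R) (m b th : R -> R).
Hypothesis O_open : open O.
Hypothesis O_itv : is_interval O.
Hypothesis m_cont : forall t, O t -> {for t, continuous m}.
Hypothesis b_cont : forall t, O t -> {for t, continuous b}.
Hypothesis b_gt : forall t s, O t -> O s -> s != t -> (s - t) * m t < b s - b t.
Local Notation M := [set m t | t in O].
Hypothesis thP : forall x, M x -> O (th x) /\ m (th x) = x.

Let m_lt t s : O t -> O s -> t < s -> m t < m s.
Proof.
move=> tT sT ts; have st : s != t by rewrite gt_eqF.
(* Adding the tangent inequalities at both ends gives [(s - t) (m s - m t) > 0]. *)
have := b_gt tT sT st.
rewrite eq_sym in st; have := b_gt sT tT st.
have st0 : 0 < s - t by rewrite subr_gt0.
by rewrite -[m t < m s](ltr_pM2l st0) => ? ?; lra.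
Qed.

Let mK t : O t -> th (m t) = t.
Proof.
move=> tT; have [|uT e] := @thP (m t); first by exists t.
have [lt|lt|//] := ltgtP (th (m t)) t.
  by have := m_lt uT tT lt; rewrite e ltxx.
by have := m_lt tT uT lt; rewrite e ltxx.
Qed.

Let th_lt x y : M x -> M y -> x < y -> th x < th y.
Proof.
move=> /thP[xT xE] /thP[yT yE] xy; rewrite ltNge; apply/negP.
rewrite le_eqVlt => /predU1P[e|]; first by move: xy; rewrite -xE -yE e ltxx.
by move=> /(m_lt yT xT); rewrite xE yE ltNge (ltW xy).
Qed.

Let M_between t s z : O t -> O s -> t <= s -> m t <= z <= m s -> M z.
Proof.
move=> tT sT ts /andP[tz zs].
have cont : {within `[t, s], continuous m}.
  apply: continuous_in_subspaceT => r; rewrite inE/= in_itv/= => rts.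
  by apply: m_cont; apply: O_itv rts.
have [|r] := @IVT R m t s z ts cont; first by rewrite ge_min le_max tz zs orbT.
rewrite in_itv/= => rts <-; exists r => //.
exact: O_itv rts.
Qed.

Let M_itv : is_interval M.
Proof.
move=> x y Mx My z /andP[xz zy].
have [xT xE] := thP Mx; have [yT yE] := thP My.
have : x <= y by exact: le_trans zy.
rewrite le_eqVlt => /predU1P[e|xy].
  by have -> // : z = x by apply/eqP; rewrite eq_le xz e zy.
apply: (M_between xT yT); first exact/ltW/th_lt.
by rewrite xE yE xz.
Qed.

Let O_pm t e : 0 < e -> O t -> exists2 r, 0 < r < e & O (t - r) /\ O (t + r).
Proof.
move=> e0 tT.
have /nbhs_ballP[e' /= e'0 he'] : nbhs t O by exact: open_nbhs_nbhs.
pose r := Num.min e e' / 2.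
have m0 : 0 < Num.min e e' by rewrite lt_min e0 e'0.
have me : Num.min e e' <= e by rewrite ge_min lexx.
have me' : Num.min e e' <= e' by rewrite ge_min lexx orbT.
exists r; first by rewrite /r; apply/andP; split; lra.
split; apply: he'; rewrite /ball/=.
  by rewrite opprB addrC subrK ger0_norm /r; lra.
by rewrite opprD addrA subrr add0r normrN ger0_norm /r; lra.
Qed.

(** The images under [m] of [th x - r] and [th x + r] enclose [x]; monotonicity of [th] and the
    intermediate value theorem give at once that [M] is open and that the inverse is continuous. *)
Let M_near x e : M x -> 0 < e -> \forall y \near x, M y /\ `|th x - th y| < e.
Proof.
move=> Mx e0; have [xT xE] := thP Mx.
have [r /andP[r0 re] [Tm Tp]] := O_pm e0 xT.
have lm : m (th x - r) < x by rewrite -[ltRHS]xE; apply: m_lt => //; lra.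
have lp : x < m (th x + r) by rewrite -[ltLHS]xE; apply: m_lt => //; lra.
have : x \in `]m (th x - r), m (th x + r)[ by rewrite in_itv/= lm lp.
move=> /near_in_itvoo; apply: filterS => y; rewrite in_itv/= => /andP[my yp].
have My : M y by apply: (M_between Tm Tp); [lra|rewrite !ltW].
split=> //.
have := @th_lt _ _ (ex_intro2 _ _ _ Tm erefl) My my.
have := @th_lt _ _ My (ex_intro2 _ _ _ Tp erefl) yp.
by rewrite !mK // ltr_norml => ? ?; apply/andP; split; lra.
Qed.

Let th_cont x : M x -> {for x, continuous th}.
Proof.
move=> Mx; apply/cvgrPdist_lt => e e0.
by apply: filterS (M_near Mx e0) => y [].
Qed.

Lemma legendre_bregman (d : R -> R -> R) :
  (forall x y, M x -> M y -> d x y = b (th y) - b (th x) - (th y - th x) * x) ->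
  bregman_divergence M d th (b \o th).
Proof.
move=> dE; split=> //.
- by move=> x Mx; apply: filterS (M_near Mx ltr01) => y [].
- move=> x y Mx My xy; rewrite dE //.
  have [xT xE] := thP Mx; have [yT yE] := thP My.
  rewrite subr_gt0 -[X in _ * X < _]xE; apply: b_gt => //.
  by apply: contra_neq xy => e; rewrite -xE -yE e.
- move=> x Mx; apply: continuous_comp; first exact: th_cont.
  by apply: b_cont; have [] := thP Mx.
Qed.

(** By continuity [m] stays within [xi] of [x] on a small window, and the tangent inequality at the
    shifted parameter bounds the increment of [b] by [s] times the mean there. The two differences
    say that the log-moment generating function of the deviation is negative. *)
Lemma legendre_chernoff x xi : M x -> 0 < xi ->
  exists s, [/\ 0 < s, O (th x + s), b (th x + s) - b (th x) < s * (x + xi),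
                O (th x - s) & b (th x - s) - b (th x) < - s * (x - xi)].
Proof.
move=> Mx xi0; have [xT xE] := thP Mx.
have := m_cont xT => /cvgrPdist_lt /(_ _ xi0) /nbhs_ballP[e /= e0 he].
have [s /andP[s0 se] [Tm Tp]] := O_pm e0 xT.
exists s.
have /he : ball (th x) e (th x + s).
  by rewrite /ball/= opprD addrA subrr add0r normrN gtr0_norm.
have /he : ball (th x) e (th x - s).
  by rewrite /ball/= opprB addrC subrK gtr0_norm.
rewrite xE /= !ltr_norml => /andP[_ h1] /andP[h2 _].
have n1 : th x != th x + s by rewrite lt_eqF //; lra.
have n2 : th x != th x - s by rewrite gt_eqF //; lra.
have b1 := b_gt Tp xT n1; have b2 := b_gt Tm xT n2.
have : s * m (th x + s) < s * (x + xi) by rewrite ltr_pM2l //; lra.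
have : s * (x - xi) < s * m (th x - s) by rewrite ltr_pM2l //; lra.
by move=> c1 c2; split => //; lra.
Qed.

End LegendreFamily.

(** For densities, [a] is the carrier [h x]. It cancels inside the logarithm when nonzero, and
    otherwise kills both sides. *)
Lemma mulr_lnV (R : realType) (a e1 e2 : R) :
  a * expR e1 * ln (a * expR e1 / (a * expR e2)) = a * expR e1 * (e1 - e2).
Proof.
have [->|a0] := eqVneq a 0; first by rewrite !mul0r.
by rewrite invfM mulrACA divff // mul1r -expRN -expRD expRK.
Qed.

Section ExponentialFamilyDivergence.
Variables (R : realType) (rho : {measure set (measurableTypeR R) -> \bar R}).
Variable h : R -> R.
Hypothesis h_ge0 : forall x, 0 <= h x.
Hypothesis h_meas : measurable_fun setT h.

Local Notation u := (ef_unnorm h).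
Local Notation Theta := (ef_Theta rho h).
Local Notation b := (ef_b rho h).
Local Notation m := (ef_mean rho h).
Local Notation M := (ef_M rho h).
Local Notation th := (ef_theta rho h).

Hypothesis M_nondeg : exists x y, [/\ M x, M y & x != y].

Lemma ef_mean_continuous t : Theta° t -> {for t, continuous m}.
Proof.
move=> tT.
have It := ef_mass_gt0 h_ge0 h_meas M_nondeg (interior_subset tT).
have : (fun s => ef_moment rho h s / ef_mass rho h s) @ t --> m t.
  rewrite (ef_meanE h_ge0 h_meas M_nondeg tT).
  apply: cvgM; first exact: ef_moment_continuous.
  by apply: cvgV; [exact: lt0r_neq0|exact: ef_mass_continuous].
apply: cvg_trans; apply: near_eq_cvg.
have : nbhs t (Theta°) by apply: open_nbhs_nbhs; split => //; exact: open_interior.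
by apply: filterS => s sT; rewrite (ef_meanE h_ge0 h_meas M_nondeg sT).
Qed.

Lemma ef_b_continuous t : Theta° t -> {for t, continuous b}.
Proof.
move=> tT; have It := ef_mass_gt0 h_ge0 h_meas M_nondeg (interior_subset tT).
apply: (@continuous_comp _ _ _ (ef_mass rho h) (@ln R)).
  exact: ef_mass_continuous.
exact: continuous_ln.
Qed.

Lemma ef_thetaP x : M x -> Theta° (th x) /\ m (th x) = x.
Proof.
move=> [t tT tx]; apply: (@xgetPex _ 0 [set t | Theta° t /\ m t = x]).
by exists t.
Qed.

Lemma ef_KLE t s : Theta° t -> Theta° s ->
  ef_KL rho h t s = b s - b t - (s - t) * m t.
Proof.
move=> tT sT.
have tT' := interior_subset tT; have sT' := interior_subset sT.
have It := ef_mass_gt0 h_ge0 h_meas M_nondeg tT'.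
rewrite /ef_KL.
(* The log-ratio of the densities is the affine function [(t - s) x + (b s - b t)], so the integrand
   is a combination of the mass and first-moment integrands. *)
pose c := (b s - b t) / ef_mass rho h t; pose k := (t - s) / ef_mass rho h t.
under eq_Rintegral => x _.
  have -> : ef_dens rho h t x * ln (ef_dens rho h t x / ef_dens rho h s x) =
      c * u t x + k * (x * u t x).
    have -> : c * u t x + k * (x * u t x) =
        ef_dens rho h t x * ((t - s) * x + (b s - b t)).
      rewrite (ef_densE h_ge0 h_meas M_nondeg) // /c /k.
      move: (b s) (b t) (ef_mass rho h t) (u t x) => bs bt I v.
      by clear -x; ring.
    rewrite /ef_dens mulr_lnV; congr (_ * _).
    move: (b s) (b t) => bs bt.
    by clear -x; ring.
  over.
rewrite RintegralD //; first last.
- exact: (integrableZl measurableT k (integrable_moment h_ge0 h_meas tT)).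
- exact: (integrableZl measurableT c tT').
rewrite !RintegralZl //; last exact: integrable_moment.
rewrite -/(ef_mass rho h t) -/(ef_moment rho h t).
rewrite (ef_meanE h_ge0 h_meas M_nondeg tT) /c /k.
move: It; move: (b s) (b t) (ef_mass rho h t) (ef_moment rho h t) => bs bt I J I0.
by clear -I0; field; exact: lt0r_neq0.
Qed.

Lemma ef_dE x y : M x -> M y ->
  ef_d rho h x y = b (th y) - b (th x) - (th y - th x) * x.
Proof.
move=> Mx My; rewrite /ef_d; have [->|xy] := eqVneq x y.
  by rewrite !subrr mul0r subr0.
rewrite mem_set // /ef_dKL.
have [xT xE] := ef_thetaP Mx; have [yT yE] := ef_thetaP My.
by rewrite ef_KLE // xE.
Qed.

Let Theta_itv : is_interval (Theta°).
Proof. move=> x y Tx Ty z; exact: Theta_interior_convex. Qed.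

Let b_gt t s : Theta° t -> Theta° s -> s != t -> (s - t) * m t < b s - b t.
Proof. by move=> tT /interior_subset; apply: ef_b_gt. Qed.

Lemma ef_bregman : bregman_divergence M (ef_d rho h) th (b \o th).
Proof.
exact: (legendre_bregman (@open_interior _ _) Theta_itv ef_mean_continuous
  ef_b_continuous b_gt ef_thetaP ef_dE).
Qed.

Lemma ef_chernoff x xi : M x -> 0 < xi ->
  exists s, [/\ 0 < s,
    Theta (th x + s), b (th x + s) - b (th x) < s * (x + xi),
    Theta (th x - s) & b (th x - s) - b (th x) < - s * (x - xi)].
Proof.
move=> Mx xi0.
have [s [s0 /interior_subset ? ? /interior_subset ? ?]] :=
  legendre_chernoff (@open_interior _ _) ef_mean_continuous b_gt ef_thetaP Mx xi0.
by exists s.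
Qed.

End ExponentialFamilyDivergence.

(** * Transportation costs and the oracle objective *)

Section Divergence.
Variables (R : realType) (M : set R) (d : R -> R -> R) (th bb : R -> R).
Hypothesis bd : bregman_divergence M d th bb.

Lemma bd_xx x : M x -> d x x = 0.
Proof. by move=> Mx; rewrite (bd_E bd) // !subrr mul0r subr0. Qed.

Lemma bd_ge0 x y : M x -> M y -> 0 <= d x y.
Proof.
move=> Mx My; have [->|xy] := eqVneq x y; first by rewrite bd_xx.
exact/ltW/(bd_gt0 bd).
Qed.

Let th_le x y : M x -> M y -> x <= y -> th x <= th y.
Proof.
move=> Mx My; rewrite le_eqVlt => /predU1P[->//|xy].
have := bd_gt0 bd Mx My (negbT (lt_eqF xy)).
have := bd_gt0 bd My Mx (negbT (gt_eqF xy)).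
rewrite !(bd_E bd) // => h1 h2.
by rewrite leNgt; apply/negP => h3; nra.
Qed.

(** Three-point identity: [d x z - d x y = d y z + (th z - th y) (y - x)]. *)
Lemma bd_le_right x y z : M x -> M z -> x <= y <= z -> d x y <= d x z.
Proof.
move=> Mx Mz /andP[xy yz]; have My : M y by apply: (bd_itv bd) Mx Mz _ _; apply/andP.
have := bd_ge0 My Mz; have := th_le My Mz yz.
by rewrite !(bd_E bd) // => h1 h2; nra.
Qed.

Lemma bd_le_left x y z : M x -> M z -> z <= y <= x -> d x y <= d x z.
Proof.
move=> Mx Mz /andP[zy yx]; have My : M y by apply: (bd_itv bd) Mz Mx _ _; apply/andP.
have := bd_ge0 My Mz; have := th_le Mz My zy.
by rewrite !(bd_E bd) // => h1 h2; nra.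
Qed.

Lemma bd_cvg T (F : set_system T) (FF : Filter F) (x y : T -> R) (x0 y0 : R) :
  M x0 -> M y0 -> x @ F --> x0 -> y @ F --> y0 ->
  (fun t => d (x t) (y t)) @ F --> d x0 y0.
Proof.
move=> Mx My xx yy.
have nx : \forall t \near F, M (x t) by apply: xx; exact: (bd_open bd).
have ny : \forall t \near F, M (y t) by apply: yy; exact: (bd_open bd).
have : (fun t => bb (y t) - bb (x t) - (th (y t) - th (x t)) * x t) @ F -->
    d x0 y0.
  rewrite (bd_E bd) //; apply: cvgB.
    by apply: cvgB; (apply: continuous_cvg; [exact: (bd_bb bd)|]).
  apply: cvgM => //.
  by apply: cvgB; (apply: continuous_cvg; [exact: (bd_th bd)|]).
apply: cvg_trans; apply: near_eq_cvg; near=> t.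
by rewrite (bd_E bd) //; [near: t; exact: nx|near: t; exact: ny].
Unshelve. all: by end_near. Qed.

(* [wmean u v x y] is the point at which [u d(x,.) + v d(y,.)] is minimal, with minimum [trans_cost u v x y]. *)
Definition wmean (u v x y : R) : R := (u * x + v * y) / (u + v).
Definition trans_cost (u v x y : R) : R :=
  u * d x (wmean u v x y) + v * d y (wmean u v x y).

Lemma wmean_itv u v x y : 0 <= u -> 0 <= v -> 0 < u + v -> x <= y ->
  x <= wmean u v x y <= y.
Proof.
move=> u0 v0 uv xy; rewrite /wmean ler_pdivlMr // ler_pdivrMr //.
by apply/andP; split; nra.
Qed.

Lemma wmeanC u v x y : wmean u v x y = wmean v u y x.
Proof. by rewrite /wmean addrC [u + v]addrC. Qed.

Lemma wmean_in u v x y : 0 <= u -> 0 <= v -> 0 < u + v -> M x -> M y ->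
  M (wmean u v x y).
Proof.
move=> u0 v0 uv Mx My; case: (lerP x y) => xy.
  exact: (bd_itv bd Mx My (wmean_itv u0 v0 uv xy)).
rewrite wmeanC; apply: (bd_itv bd My Mx); apply: wmean_itv => //; last exact: ltW.
by rewrite addrC.
Qed.

(** Compensation identity: moving the common point from the weighted mean to [l] costs exactly the
    divergence between the two, since [d] is affine in its first argument up to a term independent
    of the second. It makes the weighted mean the unique minimizer. *)
Lemma trans_costE u v x y l : 0 <= u -> 0 <= v -> 0 < u + v -> M x -> M y -> M l ->
  u * d x l + v * d y l = trans_cost u v x y + (u + v) * d (wmean u v x y) l.
Proof.
move=> u0 v0 uv Mx My Ml; have Mz := wmean_in u0 v0 uv Mx My.
rewrite /trans_cost !(bd_E bd) //.
have : wmean u v x y * (u + v) = u * x + v * y by rewrite /wmean divfK // gt_eqF.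
move: (wmean u v x y) => z zE.
have -> : (u + v) * (bb l - bb z - (th l - th z) * z) =
  (u + v) * (bb l - bb z) - (th l - th z) * (z * (u + v)) by ring.
rewrite zE; ring.
Qed.

Lemma trans_cost0 v x y : M x -> M y -> trans_cost 0 v x y = 0.
Proof.
move=> Mx My; rewrite /trans_cost mul0r add0r /wmean mul0r !add0r.
have [->|v0] := eqVneq v 0; first by rewrite mul0r.
by rewrite mulrAC divff // mul1r bd_xx // mulr0.
Qed.

Lemma trans_costC u v x y : trans_cost u v x y = trans_cost v u y x.
Proof. by rewrite /trans_cost addrC wmeanC. Qed.

Lemma trans_cost_le u v x y l : 0 <= u -> 0 <= v -> M x -> M y -> M l ->
  trans_cost u v x y <= u * d x l + v * d y l.
Proof.
move=> u0 v0 Mx My Ml.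
have : 0 <= u + v by rewrite addr_ge0.
rewrite le_eqVlt => /predU1P[/esym uv|uv].
  have [-> ->] : u = 0 /\ v = 0 by split; lra.
  by rewrite trans_cost0 // !mul0r addr0.
rewrite trans_costE // lerDl mulr_ge0 ?bd_ge0 //; last exact: wmean_in.
exact: ltW.
Qed.

Lemma trans_cost_lt u v x y l : 0 <= u -> 0 <= v -> 0 < u + v ->
  M x -> M y -> M l -> wmean u v x y != l ->
  trans_cost u v x y < u * d x l + v * d y l.
Proof.
move=> u0 v0 uv Mx My Ml nl.
rewrite trans_costE // ltrDl mulr_gt0 ?(bd_gt0 bd) //; exact: wmean_in.
Qed.

(** A weighted mean of two distinct points determines the ratio of the weights; this is the source
    of strict concavity across rays. *)
Lemma wmean_inj u v u' v' x y : x != y -> u + v != 0 -> u' + v' != 0 ->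
  wmean u v x y = wmean u' v' x y -> u * v' = u' * v.
Proof.
move=> xy uv uv' /eqP; rewrite /wmean eqr_div // => /eqP e.
have : (u * v' - u' * v) * (x - y) = 0.
  have -> : (u * v' - u' * v) * (x - y) =
    (u * x + v * y) * (u' + v') - (u' * x + v' * y) * (u + v) by ring.
  by rewrite e subrr.
by move/eqP; rewrite mulf_eq0 !subr_eq0 (negPf xy) orbF => /eqP.
Qed.

Lemma trans_cost_gt0 u v x y : 0 < u -> 0 < v -> M x -> M y -> x != y ->
  0 < trans_cost u v x y.
Proof.
move=> u0 v0 Mx My xy.
have uv : 0 < u + v by rewrite addr_gt0.
have Mz := wmean_in (ltW u0) (ltW v0) uv Mx My.
have [xz|xz] := eqVneq x (wmean u v x y).
  rewrite /trans_cost -xz bd_xx // mulr0 add0r mulr_gt0 // (bd_gt0 bd) //.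
  by rewrite eq_sym.
have := bd_gt0 bd Mx Mz xz; have := bd_ge0 My Mz.
by rewrite /trans_cost => h1 h2; rewrite ltr_wpDr ?mulr_gt0 // mulr_ge0 // ltW.
Qed.

(** Homogeneity turns [Zab] at the pull counts into the total cost times a transportation cost at
    the counts per unit of cost. *)
Lemma trans_costZ k u v x y : k != 0 ->
  trans_cost (k * u) (k * v) x y = k * trans_cost u v x y.
Proof.
move=> k0; rewrite /trans_cost.
have -> : wmean (k * u) (k * v) x y = wmean u v x y.
  by rewrite /wmean -!mulrA -!mulrDr invfM mulrACA divff // mul1r.
by rewrite mulrDr !mulrA.
Qed.

Lemma trans_cost_cvg T (F : set_system T) (FF : Filter F) (u v x y : T -> R) (u0 v0 x0 y0 : R) :
  0 <= u0 -> 0 <= v0 -> 0 < u0 + v0 -> M x0 -> M y0 ->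
  u @ F --> u0 -> v @ F --> v0 -> x @ F --> x0 -> y @ F --> y0 ->
  (fun t => trans_cost (u t) (v t) (x t) (y t)) @ F --> trans_cost u0 v0 x0 y0.
Proof.
move=> hu hv uv Mx My uu vv xx yy.
have zz : (fun t => wmean (u t) (v t) (x t) (y t)) @ F --> wmean u0 v0 x0 y0.
  apply: cvgM; first by apply: cvgD; apply: cvgM.
  by apply: cvgV; [rewrite gt_eqF|exact: cvgD].
have Mz := wmean_in hu hv uv Mx My.
by apply: cvgD; apply: cvgM => //; apply: bd_cvg.
Qed.

End Divergence.

(** * Reduction of the infimum over alternatives to pairwise transportation costs *)

Section Objective.
Variables (R : realType) (M : set R) (d : R -> R -> R) (th bb : R -> R).
Hypothesis bd : bregman_divergence M d th bb.
Variables (K : nat) (K_ge2 : (2 <= K)%N).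
Implicit Types (m c w lam : 'I_K -> R).

Lemma is_best_uniq m a b : is_best m a -> is_best m b -> a = b.
Proof.
move=> ha hb; apply/eqP; apply/negPn/negP => ab.
have := ha b; rewrite eq_sym ab => /(_ isT) h1.
by have := hb a ab; rewrite ltNge (ltW h1).
Qed.

Lemma alt_challenger m a0 lam : is_best m a0 -> alt M m lam ->
  exists2 b, b != a0 & lam a0 < lam b.
Proof.
move=> ma0 [_ [[b lb] nb]]; have ba0 : b != a0.
  by apply/eqP => e; apply: (nb a0 ma0); rewrite -e.
by exists b => //; apply: lb; rewrite eq_sym.
Qed.

Lemma exists_neq (a : 'I_K) : exists b : 'I_K, b != a.
Proof.
have K0 : (0 < K)%N by exact: leq_trans K_ge2.
case: (eqVneq a (Ordinal K0)) => [->|na]; last by exists (Ordinal K0); rewrite eq_sym.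
by exists (Ordinal K_ge2).
Qed.

Lemma alt_nonempty m a0 : (forall a, M (m a)) -> is_best m a0 -> exists lam, alt M m lam.
Proof.
move=> Mm ma0; have [b ba0] := exists_neq a0.
have lb : is_best (fun a => m (tperm a0 b a)) b.
  move=> a ab; rewrite tpermR; apply: ma0.
  by apply: contra_neq ab => e; rewrite -[a](tpermK a0 b) e tpermL.
exists (fun a => m (tperm a0 b a)); split; first by move=> a; exact: Mm.
split; first by exists b.
move=> a /(is_best_uniq ma0) <- /(is_best_uniq lb) e.
by rewrite e eqxx in ba0.
Qed.

(** Two means placed in the reverse order can be merged into one point [z] without increasing either
    divergence, by monotonicity of [d] on each side of its first argument. *)
Lemma trans_cost_le_pair u v x y l1 l2 : 0 <= u -> 0 <= v -> M x -> M y -> M l1 -> M l2 ->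
  y < x -> l1 < l2 -> trans_cost d u v x y <= u * d x l1 + v * d y l2.
Proof.
move=> u0 v0 Mx My Ml1 Ml2 yx l12.
suff [z [Mz h1 h2]] : exists z, [/\ M z, d x z <= d x l1 & d y z <= d y l2].
  apply: (le_trans (trans_cost_le bd u0 v0 Mx My Mz)).
  by rewrite lerD // ler_wpM2l.
case: (lerP x l1) => xl1.
  exists x; split => //; first by rewrite (bd_xx bd) // (bd_ge0 bd).
  by apply: (bd_le_right bd) => //; rewrite (ltW yx) (le_trans xl1 (ltW l12)).
case: (lerP l2 y) => l2y.
  exists y; split => //; last by rewrite (bd_xx bd) // (bd_ge0 bd).
  by apply: (bd_le_left bd) => //; rewrite (ltW yx) (le_trans (ltW l12) l2y).
have [z /andP[z1 z2] /andP[z3 z4]] : exists2 z, l1 <= z <= x & y <= z <= l2.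
  case: (lerP l1 y) => l1y.
    by exists y; rewrite ?l1y ?lexx ?(ltW l2y) ?(ltW yx).
  by exists l1; rewrite ?lexx ?(ltW l1y) ?(ltW l12) ?(ltW xl1).
have Mz : M z by apply: (bd_itv bd) Ml1 Mx _ _; rewrite z1 z2.
exists z; split => //.
  by apply: (bd_le_left bd) => //; rewrite z1.
by apply: (bd_le_right bd) => //; rewrite z3.
Qed.

Lemma ctas_obj_ge m c w a0 r : (forall a, M (m a)) -> is_best m a0 ->
  (forall a, 0 <= w a) -> (forall a, 0 < c a) ->
  (forall b, b != a0 ->
    r <= trans_cost d (w a0 / c a0) (w b / c b) (m a0) (m b)) ->
  r <= ctas_obj M d m c w.
Proof.
move=> Mm ma0 w0 c0 hr; apply: lb_le_inf.
  by have [lam hl] := alt_nonempty Mm ma0; eexists; exists lam.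
move=> _ [lam lalt <-]; have [Ml _] := lalt.
have [b ba0 lb] := alt_challenger ma0 lalt.
have v0 a : 0 <= w a / c a by rewrite divr_ge0 // ltW.
rewrite (bigD1 a0) //= (bigD1 b) //= addrA.
apply: (le_trans (hr b ba0)); apply: ler_wpDr; last first.
  by apply: trans_cost_le_pair => //; exact: ma0.
apply: sumr_ge0 => a _.
by apply: mulr_ge0; [exact: v0|exact: (bd_ge0 bd)].
Qed.

Lemma ctas_obj_le m c w lam : (forall a, M (m a)) ->
  (forall a, 0 <= w a) -> (forall a, 0 < c a) -> alt M m lam ->
  ctas_obj M d m c w <= \sum_a w a / c a * d (m a) (lam a).
Proof.
move=> Mm w0 c0 ml; apply: ge_inf; last by exists lam.
exists 0 => _ [l [Ml _] <-].
apply: sumr_ge0 => a _; apply: mulr_ge0; last exact: (bd_ge0 bd).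
by rewrite divr_ge0 // ltW.
Qed.

(* Perturb the configuration "arms [a0] and [b] at their weighted mean, the others unchanged" by raising its best arm other than [a0]. *)
Lemma ctas_obj_le_trans_cost m c w a0 b : (forall a, M (m a)) -> is_best m a0 ->
  (forall a, 0 <= w a) -> (forall a, 0 < c a) -> b != a0 ->
  ctas_obj M d m c w <= trans_cost d (w a0 / c a0) (w b / c b) (m a0) (m b).
Proof.
move=> Mm ma0 w0 c0 ba0.
have v0 a : 0 <= w a / c a by rewrite divr_ge0 // ltW.
set u := w a0 / c a0; set v := w b / c b.
have [z Mz Gz] : exists2 z, M z & u * d (m a0) z + v * d (m b) z = trans_cost d u v (m a0) (m b).
  have : 0 <= u + v by rewrite addr_ge0 // v0.
  rewrite le_eqVlt => /predU1P[/esym uv|uv]; last first.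
    by exists (wmean u v (m a0) (m b)) => //; apply: (wmean_in bd) => //; exact: v0.
  (* With both weights zero the weighted mean is a quotient by 0, possibly outside [M]; any point of
     [M] serves as [z]. *)
  have [-> ->] : u = 0 /\ v = 0 by have := v0 a0; have := v0 b; rewrite -/u -/v; split; lra.
  by exists (m b) => //; rewrite (trans_cost0 bd) // !mul0r addr0.
pose l0 a := if (a == a0) || (a == b) then z else m a.
have Ml0 a : M (l0 a) by rewrite /l0; case: ifP.
have l0a0 : l0 a0 = z by rewrite /l0 eqxx.
have l0b : l0 b = z by rewrite /l0 eqxx orbT.
have [j ja0 jmax] : exists2 j, j != a0 & forall a, a != a0 -> l0 a <= l0 j.
  have [j ja0 jmax] := @arg_maxP _ _ _ b (fun a => a != a0) l0 ba0.
  by exists j.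
have zj : z <= l0 j by rewrite -l0b; exact: jmax.
pose le (e : R) a := if a == j then l0 j + e else l0 a.
have S0 : \sum_a w a / c a * d (m a) (l0 a) = trans_cost d u v (m a0) (m b).
  rewrite (bigD1 a0) //= (bigD1 b) //= l0a0 l0b big1 ?addr0 // => a /andP[aa0 ab].
  by rewrite /l0 (negPf aa0) (negPf ab) (bd_xx bd) // mulr0.
have SE e : \sum_a w a / c a * d (m a) (le e a) =
    trans_cost d u v (m a0) (m b) + w j / c j * (d (m j) (l0 j + e) - d (m j) (l0 j)).
  rewrite -S0 (bigD1 j) //= [in RHS](bigD1 j) //= /le eqxx.
  rewrite (eq_bigr (fun a => w a / c a * d (m a) (l0 a))); last first.
    by move=> a /negPf ->.
  ring.
have cv : (fun e => w j / c j * (d (m j) (l0 j + e) - d (m j) (l0 j))) @ (0 : R)^'+ --> (0 : R).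
  have -> : (0 : R) = w j / c j * (d (m j) (l0 j) - d (m j) (l0 j)).
    by rewrite subrr mulr0.
  apply: cvgM; first exact: cvg_cst.
  apply: cvgB; last exact: cvg_cst.
  rewrite subrr mulr0; apply: (bd_cvg bd) => //; first exact: cvg_cst.
  rewrite -[X in _ --> X]addr0; apply: cvgD; first exact: cvg_cst.
  exact: cvg_at_right_filter.
apply/ler_addgt0Pr => e e0.
have nM : \forall t \near (0 : R)^'+, M (l0 j + t).
  have : (fun t => l0 j + t) @ (0 : R)^'+ --> l0 j.
    rewrite -[X in _ --> X]addr0; apply: cvgD; first exact: cvg_cst.
    exact: cvg_at_right_filter.
  by apply; exact: (bd_open bd).
have [t [t0 Mt te]] : exists t, [/\ 0 < t, M (l0 j + t) &
    w j / c j * (d (m j) (l0 j + t) - d (m j) (l0 j)) < e].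
  have : \forall t \near (0 : R)^'+, [/\ 0 < t, M (l0 j + t) &
    w j / c j * (d (m j) (l0 j + t) - d (m j) (l0 j)) < e].
    near=> t; split.
    - by near: t; exact: nbhs_right_gt.
    - by near: t; exact: nM.
    - by near: t; apply: (cvgr_lt 0).
  by move/filter_ex.
have lbest : is_best (le t) j.
  move=> a aj; rewrite /le eqxx (negPf aj).
  have [->|aa0] := eqVneq a a0; first by rewrite l0a0; lra.
  by have := jmax a aa0; lra.
have lalt : alt M m (le t).
  split; first by move=> a; rewrite /le; case: ifP.
  split; first by exists j.
  move=> a /(is_best_uniq ma0) <- /(is_best_uniq lbest) e1.
  by rewrite e1 eqxx in ja0.
apply: (le_trans (ctas_obj_le Mm w0 c0 lalt)).
by rewrite SE lerD2l ltW.
Unshelve. all: by end_near. Qed.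

End Objective.

(** * Uniqueness and stability of the optimal weights *)

Section UniformNeighbourhoods.
Variables (R : realType) (J : Type).
Implicit Types (x y : J -> R).

(** Balls for the uniform distance: an eventual statement unpacks into a single radius valid for all
    arms. *)
Definition unif_nbhs x : set_system (J -> R) :=
  filter_from [set e | 0 < e] (fun e => [set y | forall a, `|x a - y a| < e]).

Global Instance unif_nbhs_filter x : Filter (unif_nbhs x).
Proof.
apply: filter_from_filter; first by exists 1 => /=.
move=> e1 e2 /= h1 h2; exists (Num.min e1 e2) => /=; first by rewrite lt_min h1 h2.
by move=> y /= hy; split=> a; have := hy a; rewrite lt_min => /andP[].
Qed.

Lemma cvg_unif_nbhs x a : (fun y => y a) @ unif_nbhs x --> x a.
Proof. by apply/cvgrPdist_lt => e e0; exists e. Qed.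

End UniformNeighbourhoods.

Section Maximizer.
Variables (R : realType) (M : set R) (d : R -> R -> R) (th bb : R -> R).
Hypothesis bd : bregman_divergence M d th bb.
Variables (K : nat) (K_ge2 : (2 <= K)%N).
Implicit Types (m c w lam : 'I_K -> R).
Variables (mu c : 'I_K -> R) (a0 : 'I_K).
Hypothesis Mmu : forall a, M (mu a).
Hypothesis mu_a0 : is_best mu a0.
Hypothesis c_gt0 : forall a, 0 < c a.
Local Notation obj := (ctas_obj M d).
Local Notation G w b := (trans_cost d (w a0 / c a0) (w b / c b) (mu a0) (mu b)).

Definition is_maximizer m c' w :=
  simplex w /\ forall w', simplex w' -> obj m c' w' <= obj m c' w.

(** An infimum over alternatives could lose strictness; the finite minimum [s] of the transportation
    costs, capped at [r + 1], lies strictly between. *)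
Lemma obj_gt w r : (forall a, 0 <= w a) -> (forall b, b != a0 -> r < G w b) ->
  r < obj mu c w.
Proof.
move=> w0 hr; pose s := \big[Num.min/r + 1]_(b | b != a0) G w b.
apply: (@lt_le_trans _ _ s); first by apply: lt_bigmin => //; rewrite ltrDl.
by apply: (ctas_obj_ge bd K_ge2 Mmu mu_a0) => // b hb; exact: bigmin_le_cond.
Qed.

Lemma mu_neq b : b != a0 -> mu a0 != mu b.
Proof. by move=> /mu_a0 h; rewrite gt_eqF. Qed.

Lemma simplex_unif : simplex (fun _ : 'I_K => (K%:R : R)^-1).
Proof.
split=> [a|]; first by rewrite invr_ge0.
rewrite sumr_const card_ord -[LHS]mulr_natl divff //.
by rewrite pnatr_eq0 -lt0n; exact: leq_trans K_ge2.
Qed.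

Variable ws : 'I_K -> R.
Hypothesis ws_max : is_maximizer mu c ws.
Local Notation V := (obj mu c ws).

Lemma maximum_gt0 : 0 < V.
Proof.
apply: lt_le_trans (proj2 ws_max _ simplex_unif).
have K0 : (0 : R) < K%:R^-1 by rewrite invr_gt0 ltr0n; exact: leq_trans K_ge2.
apply: obj_gt => [a|b hb]; first exact: ltW.
by apply: (trans_cost_gt0 bd) => //; [rewrite divr_gt0|rewrite divr_gt0|exact: mu_neq].
Qed.

Lemma maximizer_le_G w b : is_maximizer mu c w -> b != a0 -> V <= G w b.
Proof.
move=> [sw wm] hb; apply: (le_trans (wm _ (proj1 ws_max))).
exact: (ctas_obj_le_trans_cost bd Mmu mu_a0 (proj1 sw)).
Qed.

(** A zero weight at [a0] or at a challenger would make some transportation cost vanish, below the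
    positive maximum. *)
Lemma maximizer_gt0 w a : is_maximizer mu c w -> 0 < w a.
Proof.
move=> wm; have [sw _] := wm.
have V0 := maximum_gt0.
have pos b : b != a0 -> w a0 != 0 /\ w b != 0.
  move=> hb; have := lt_le_trans V0 (maximizer_le_G wm hb).
  have [->|_] := eqVneq (w a0) 0; first by rewrite mul0r (trans_cost0 bd) // ltxx.
  have [->|//] := eqVneq (w b) 0.
  by rewrite mul0r trans_costC (trans_cost0 bd) // ltxx.
have [b hb] := exists_neq K_ge2 a0.
rewrite lt_neqAle (proj1 sw) andbT eq_sym.
have [->|/pos[]//] := eqVneq a a0; by have [] := pos b hb.
Qed.

(** As a minimum of functions linear in the weights, the transportation cost is concave: evaluate
    both pairs at the minimizer of the midpoint. Equality forces both weighted means to be that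
    point, hence proportional weights. *)
Lemma trans_cost_mid_le u v u' v' x y : 0 < u -> 0 < v -> 0 < u' -> 0 < v' ->
  M x -> M y -> x != y ->
  trans_cost d u v x y + trans_cost d u' v' x y
    <= 2 * trans_cost d ((u + u') / 2) ((v + v') / 2) x y /\
  (u * v' != u' * v ->
   trans_cost d u v x y + trans_cost d u' v' x y
    < 2 * trans_cost d ((u + u') / 2) ((v + v') / 2) x y).
Proof.
move=> u0 v0 u'0 v'0 Mx My xy.
have U0 : 0 <= (u + u') / 2 by lra.
have V0 : 0 <= (v + v') / 2 by lra.
have UV : 0 < (u + u') / 2 + (v + v') / 2 by lra.
have Ml := wmean_in bd U0 V0 UV Mx My.
have -> : 2 * trans_cost d ((u + u') / 2) ((v + v') / 2) x y =
    (u * d x (wmean ((u + u') / 2) ((v + v') / 2) x y) +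
     v * d y (wmean ((u + u') / 2) ((v + v') / 2) x y)) +
    (u' * d x (wmean ((u + u') / 2) ((v + v') / 2) x y) +
     v' * d y (wmean ((u + u') / 2) ((v + v') / 2) x y)).
  by rewrite /trans_cost; field.
move: Ml; move: (wmean ((u + u') / 2) _ _ _) => l Ml.
have uv : 0 < u + v by lra.
have uv' : 0 < u' + v' by lra.
have le1 := trans_cost_le bd (ltW u0) (ltW v0) Mx My Ml.
have le2 := trans_cost_le bd (ltW u'0) (ltW v'0) Mx My Ml.
split; first exact: lerD.
move=> nray; have [e1|n1] := eqVneq (wmean u v x y) l; last first.
  apply: ltr_leD => //.
  exact: (trans_cost_lt bd (ltW u0) (ltW v0)).
apply: ler_ltD => //.
apply: (trans_cost_lt bd (ltW u'0) (ltW v'0)) => //.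
apply: contra_neq nray => e2; apply: (@wmean_inj _ _ _ _ _ x y) => //.
- by rewrite gt_eqF.
- by rewrite gt_eqF.
- by rewrite e1 e2.
Qed.

(* If two maximizers differ, their midpoint [w] has slack against some arm [b1]; moving a little weight from [b1] to all the other arms then increases the objective strictly. *)
Lemma maximizer_uniq w : is_maximizer mu c w -> w = ws.
Proof.
move=> wm; have V0 := maximum_gt0.
have [[w0 w1] _] := wm; have [[s0 s1] sm] := ws_max.
have wp a := maximizer_gt0 a wm; have sp a := maximizer_gt0 a ws_max.
apply: contrapT => nww.
pose z a := (w a + ws a) / 2.
have zE a : z a / c a = (w a / c a + ws a / c a) / 2 by rewrite /z; lra.
have zp a : 0 < z a by rewrite /z; have := wp a; have := sp a; lra.
have z1 : \sum_a z a = 1.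
  rewrite /z -mulr_suml big_split /= w1 s1 -[1 + 1]/(2%:R) divff //.
have vp (v : 'I_K -> R) : (forall a, 0 < v a) -> forall a, 0 < v a / c a.
  by move=> hv a; rewrite divr_gt0.
have Gz b : b != a0 -> V <= G z b.
  move=> hb; rewrite !zE.
  have [h _] := trans_cost_mid_le (vp _ wp a0) (vp _ wp b) (vp _ sp a0) (vp _ sp b)
    (Mmu a0) (Mmu b) (mu_neq hb).
  have := maximizer_le_G wm hb; have := maximizer_le_G ws_max hb.
  move: h; lra.
have [b1 hb1 Gb1] : exists2 b1, b1 != a0 & V < G z b1.
  apply: contrapT => nb; apply: nww.
  (* Without slack every pair is proportional; summing over [b] and using that both vectors sum to 1
     identifies [w] with [ws]. *)
  have par b : w a0 * ws b = ws a0 * w b.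
    have [->|hb] := eqVneq b a0; first by rewrite mulrC.
    apply/eqP/negPn/negP => npar; apply: nb; exists b => //; rewrite !zE.
    have [_ h] := trans_cost_mid_le (vp _ wp a0) (vp _ wp b) (vp _ sp a0) (vp _ sp b)
      (Mmu a0) (Mmu b) (mu_neq hb).
    have /h : w a0 / c a0 * (ws b / c b) != ws a0 / c a0 * (w b / c b).
      apply: contra npar => /eqP e; apply/eqP.
      have ca : c a0 != 0 by rewrite gt_eqF.
      have cb : c b != 0 by rewrite gt_eqF.
      have -> : w a0 * ws b = w a0 / c a0 * (ws b / c b) * (c a0 * c b) by field; rewrite ca cb.
      by rewrite e; field; rewrite ca cb.
    have := maximizer_le_G wm hb; have := maximizer_le_G ws_max hb.
    lra.
  have wa0 : w a0 = ws a0.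
    by rewrite -[LHS]mulr1 -s1 mulr_sumr (eq_bigr _ (fun b _ => par b)) -mulr_sumr w1 mulr1.
  apply/funext => b; have := par b; rewrite wa0 => /mulfI ->//.
  by rewrite gt_eqF.
have zb1 : z b1 < 1.
  have [b hb] := exists_neq K_ge2 b1.
  rewrite -z1 (bigD1 b1) //= (bigD1 b) //= ltrDl ltr_pwDl //.
  by apply: sumr_ge0 => a _; exact: ltW.
(* Scaling all other arms by [1 + e] adds mass [e (1 - z b1)], which is taken from [b1]. Against any
   other challenger the cost is multiplied by [1 + e]; against [b1] the slack survives for small
   [e]. *)
pose y (e : R) a := if a == b1 then z b1 - e * (1 - z b1) else (1 + e) * z a.
have y1 e : \sum_a y e a = 1.
  rewrite (bigD1 b1) //= /y eqxx.
  rewrite (eq_bigr (fun a => (1 + e) * z a)); last by move=> a /negPf ->.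
  rewrite -mulr_sumr; move: z1; rewrite (bigD1 b1) //= => h.
  have -> : \sum_(i < K | i != b1) z i = 1 - z b1 by move: h => <-; rewrite addrC addrK.
  ring.
have cb : (fun e => z b1 - e * (1 - z b1)) @ (0 : R)^'+ --> z b1.
  have E0 : z b1 = z b1 - 0 * (1 - z b1) by rewrite mul0r subr0.
  rewrite [X in _ --> X]E0.
  apply: cvgB; first exact: cvg_cst.
  apply: cvgM; last exact: cvg_cst.
  exact: cvg_at_right_filter.
have ca : (fun e => (1 + e) * z a0) @ (0 : R)^'+ --> z a0.
  have E0 : z a0 = (1 + 0) * z a0 by rewrite addr0 mul1r.
  rewrite [X in _ --> X]E0.
  apply: cvgM; last exact: cvg_cst.
  apply: cvgD; first exact: cvg_cst.
  exact: cvg_at_right_filter.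
have cG : (fun e => trans_cost d ((1 + e) * z a0 / c a0)
    ((z b1 - e * (1 - z b1)) / c b1) (mu a0) (mu b1)) @ (0 : R)^'+ --> G z b1.
  apply: (trans_cost_cvg bd) => //; try exact: cvg_cst; try exact/ltW/vp.
  - by rewrite addr_gt0 ?vp.
  - by apply: cvgM; [exact: ca|exact: cvg_cst].
  - by apply: cvgM; [exact: cb|exact: cvg_cst].
have [e [e0 ye0 ybG]] : exists e, [/\ 0 < e, 0 < z b1 - e * (1 - z b1) &
    V < trans_cost d ((1 + e) * z a0 / c a0) ((z b1 - e * (1 - z b1)) / c b1)
         (mu a0) (mu b1)].
  have : \forall e \near (0 : R)^'+, [/\ 0 < e, 0 < z b1 - e * (1 - z b1) &
    V < trans_cost d ((1 + e) * z a0 / c a0) ((z b1 - e * (1 - z b1)) / c b1)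
         (mu a0) (mu b1)].
    near=> e; split.
    - by near: e; exact: nbhs_right_gt.
    - by near: e; apply: (cvgr_gt (z b1)).
    - by near: e; exact: (cvgr_gt (G z b1)).
  by move/filter_ex.
have ye_ge0 a : 0 <= y e a.
  rewrite /y; case: ifP => _; first exact: ltW.
  by apply: mulr_ge0; [lra|exact: ltW].
have : V < obj mu c (y e).
  apply: obj_gt => // b hb.
  have ya0 : y e a0 = (1 + e) * z a0 by rewrite /y eq_sym (negPf hb1).
  rewrite ya0 /y; case: eqP => [->//|_].
  rewrite -(mulrA _ (z a0)) -(mulrA _ (z b)) trans_costZ; last by rewrite gt_eqF //; lra.
  apply: (le_lt_trans (Gz b hb)).
  by rewrite ltr_pMl; [lra|exact: lt_le_trans (Gz b hb)].
by rewrite ltNge sm.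
Unshelve. all: by end_near. Qed.

End Maximizer.

Lemma unif_nbhs_prod (R : realType) (J : Type) (x y : J -> R) (P : set ((J -> R) * (J -> R))) :
  filter_prod (unif_nbhs x) (unif_nbhs y) P ->
  exists2 e, 0 < e & forall x' y', (forall a, `|x a - x' a| < e) ->
    (forall a, `|y a - y' a| < e) -> P (x', y').
Proof.
move=> [[A B] /= [[e1 /= e10 h1] [e2 /= e20 h2]] AB].
exists (Num.min e1 e2); first by rewrite lt_min e10 e20.
move=> x' y' hx hy; apply: AB; split => /=.
  by apply: h1 => a; have := hx a; rewrite lt_min => /andP[].
by apply: h2 => a; have := hy a; rewrite lt_min => /andP[].
Qed.

Lemma cvg_sumr (R : realType) (T I : Type) (F : set_system T) (FF : Filter F)
    (r : seq I) (f : I -> T -> R) (l : I -> R) :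
  (forall i, f i @ F --> l i) ->
  (fun t => \sum_(i <- r) f i t) @ F --> \sum_(i <- r) l i.
Proof.
move=> fl; elim: r => [|i r ih].
  by rewrite big_nil; under eq_fun do rewrite big_nil; exact: cvg_cst.
rewrite big_cons; under eq_fun do rewrite big_cons.
exact: cvgD.
Qed.

Lemma filterS4 (T : Type) (F : set_system T) {FF : Filter F} (P1 P2 P3 P4 Q : set T) :
  (forall x, P1 x -> P2 x -> P3 x -> P4 x -> Q x) -> F P1 -> F P2 -> F P3 -> F P4 -> F Q.
Proof.
move=> PQ F1 F2 F3 F4; apply: filterS (filterI (filterI F1 F2) (filterI F3 F4)).
by move=> x [[? ?] [? ?]]; exact: PQ.
Qed.

(** * Continuity of the optimal weights at the true parameters *)

Section Stability.
Variables (R : realType) (M : set R) (d : R -> R -> R) (th bb : R -> R).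
Hypothesis bd : bregman_divergence M d th bb.
Variables (K : nat) (K_ge2 : (2 <= K)%N).
Implicit Types (m c w lam : 'I_K -> R).
Variables (mu c : 'I_K -> R) (a0 : 'I_K).
Hypothesis Mmu : forall a, M (mu a).
Hypothesis mu_a0 : is_best mu a0.
Hypothesis c_gt0 : forall a, 0 < c a.
Local Notation obj := (ctas_obj M d).
Variable ws : 'I_K -> R.
Hypothesis ws_max : is_maximizer M d mu c ws.
Local Notation V := (obj mu c ws).

Lemma near_trans_cost T (F : set_system T) {FF : Filter F} (m v : T -> 'I_K -> R) r :
  (forall a, (fun t => m t a) @ F --> mu a) ->
  (forall a, (fun t => v t a) @ F --> ws a / c a) -> r < V ->
  \forall t \near F, forall b, b != a0 ->
    r < trans_cost d (v t a0) (v t b) (m t a0) (m t b).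
Proof.
move=> hm hv rV; apply: filter_forall => b.
have [->|hb] := eqVneq b a0; first by exact: nearW.
have vp a : 0 < ws a / c a.
  by rewrite divr_gt0 // (maximizer_gt0 bd K_ge2 Mmu mu_a0 c_gt0 ws_max).
have : \forall t \near F, r < trans_cost d (v t a0) (v t b) (m t a0) (m t b).
  apply: cvgr_gt; last first.
    exact: lt_le_trans rV (maximizer_le_G bd Mmu mu_a0 c_gt0 ws_max ws_max hb).
  apply: (trans_cost_cvg bd) => //; try exact: ltW.
  exact: addr_gt0.
by apply: filterS => t ht _.
Qed.

Lemma near_M T (F : set_system T) {FF : Filter F} (m : T -> 'I_K -> R) :
  (forall a, (fun t => m t a) @ F --> mu a) ->
  \forall t \near F, forall a, M (m t a).
Proof.
by move=> hm; apply: filter_forall => a; apply: hm; exact: (bd_open bd).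
Qed.

Lemma near_is_best T (F : set_system T) {FF : Filter F} (m : T -> 'I_K -> R) :
  (forall a, (fun t => m t a) @ F --> mu a) ->
  \forall t \near F, is_best (m t) a0.
Proof.
move=> hm; apply: filter_forall => b.
have [->|hb] := eqVneq b a0; first by exact: nearW.
have := mu_a0 hb; rewrite -subr_gt0 => h.
have : (fun t => m t a0 - m t b) @ F --> mu a0 - mu b by exact: cvgB.
move=> /cvgr_gt /(_ _ h); apply: filterS => t.
by rewrite subr_gt0.
Qed.

Lemma near_pos T (F : set_system T) {FF : Filter F} (c' : T -> 'I_K -> R) :
  (forall a, (fun t => c' t a) @ F --> c a) ->
  \forall t \near F, forall a, 0 < c' t a.
Proof.
by move=> hc; apply: filter_forall => a; apply: (cvgr_gt (c a)).
Qed.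

Lemma trans_cost_stable r : r < V ->
  exists2 e, 0 < e & forall m v, (forall a, `|mu a - m a| < e) ->
    (forall a, `|ws a / c a - v a| < e) ->
    (forall a, M (m a)) /\
    forall b, b != a0 -> r < trans_cost d (v a0) (v b) (m a0) (m b).
Proof.
move=> rV; pose x a := ws a / c a.
have [|e e0 he] := @unif_nbhs_prod _ _ mu x (fun p => (forall a, M (p.1 a)) /\
    forall b, b != a0 -> r < trans_cost d (p.2 a0) (p.2 b) (p.1 a0) (p.1 b)); last first.
  by exists e => // m v hm hv; exact: (he m v).
have c1 a : (fun p : ('I_K -> R) * ('I_K -> R) => p.1 a) @
    filter_prod (unif_nbhs mu) (unif_nbhs x) --> mu a.
  exact: (cvg_comp _ _ cvg_fst (@cvg_unif_nbhs _ _ mu a)).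
have c2 a : (fun p : ('I_K -> R) * ('I_K -> R) => p.2 a) @
    filter_prod (unif_nbhs mu) (unif_nbhs x) --> x a.
  exact: (cvg_comp _ _ cvg_snd (@cvg_unif_nbhs _ _ x a)).
by apply: filterI; [exact: near_M c1|exact: near_trans_cost c1 c2 rV].
Qed.

(** A near-optimal alternative at the limit remains an alternative nearby, since the best arm is
    still [a0]; the objective there is at most its continuous sum. *)
Lemma obj_usc w r : (forall a, 0 <= w a) -> obj mu c w < r ->
  forall T (F : set_system T) {FF : Filter F} (m c' w' : T -> 'I_K -> R),
  (forall a, (fun t => m t a) @ F --> mu a) ->
  (forall a, (fun t => c' t a) @ F --> c a) ->
  (forall a, (fun t => w' t a) @ F --> w a) ->
  \forall t \near F, (forall a, 0 <= w' t a) -> obj (m t) (c' t) (w' t) < r.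
Proof.
move=> w0 wr T F FF m c' w' hm hc hw.
have [lam lalt lr] : exists2 lam, alt M mu lam &
    \sum_a w a / c a * d (mu a) (lam a) < r.
  have hinf : has_inf [set \sum_a w a / c a * d (mu a) (lam a) | lam in alt M mu].
    split; first by have [lam hl] := alt_nonempty K_ge2 Mmu mu_a0; eexists; exists lam.
    exists 0 => _ [l [Ml _] <-].
    apply: sumr_ge0 => a _; apply: mulr_ge0; last exact: (bd_ge0 bd).
    by rewrite divr_ge0 // ltW.
  have [|x [lam lalt <-] hx] := @inf_adherent _ _ (r - obj mu c w) _ hinf.
    by rewrite subr_gt0.
  by exists lam => //; apply: (lt_le_trans hx); rewrite addrC subrK.
have [Ml [lbest nlam]] := lalt.
have nr : \forall t \near F, \sum_a w' t a / c' t a * d (m t a) (lam a) < r.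
  apply: cvgr_lt lr; apply: cvg_sumr => a.
  apply: cvgM; last by apply: (bd_cvg bd) => //; exact: cvg_cst.
  by apply: cvgM => //; apply: cvgV => //; rewrite gt_eqF.
have n1 : \forall t \near F, forall a, M (m t a) by exact: near_M.
have n2 : \forall t \near F, is_best (m t) a0 by exact: near_is_best.
have n3 : \forall t \near F, forall a, 0 < c' t a by exact: near_pos.
apply: filterS4 n1 n2 n3 nr => t Mm mb cp sr wp; apply: le_lt_trans sr.
apply: (ctas_obj_le bd Mm wp cp); split => //; split => // a ma.
by apply: nlam; rewrite (is_best_uniq ma mb).
Qed.

(** The weights at distance at least [e] from [ws] in the sum norm, as row vectors so that the
    compactness of boxes in ['rV] applies. *)
Let Kset (e : R) : set 'rV[R]_K :=
  [set x : 'rV[R]_K | simplex (fun a => x ord0 a)] `&`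
  [set x : 'rV[R]_K | e <= \sum_a `|x ord0 a - ws a|].

Let Kset_compact e : compact (Kset e).
Proof.
pose C := [set x : 'rV[R]_K | forall a, x ord0 a \in `[(0 : R), (1 : R)]].
pose f (x : 'rV[R]_K) := \sum_a x ord0 a.
pose g (x : 'rV[R]_K) := \sum_a `|x ord0 a - ws a|.
have fc : continuous f.
  by move=> x; apply: (@cvg_sumr _ _ _ _ (nbhs_filter x)) => a; exact: coord_continuous.
have gc : continuous g.
  move=> x; apply: (@cvg_sumr _ _ _ _ (nbhs_filter x)) => a; apply: cvg_norm; apply: cvgB; last exact: cvg_cst.
  exact: coord_continuous.
have cC : compact C.
  apply: (@rV_compact _ _ (fun=> `[(0 : R), (1 : R)]%classic)) => a.
  exact: segment_compact.
have -> : Kset e = C `&` (f @^-1` [set y | y = 1] `&` g @^-1` [set y | e <= y]).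
  apply/seteqP; split=> x /=.
    move=> [[x0 x1] xe]; split => // a; rewrite in_itv/= x0 -x1 /=.
    by rewrite (bigD1 a) //= lerDl; apply: sumr_ge0.
  move=> [xC [x1 xe]]; split => //; split => // a.
  by have := xC a; rewrite /= in_itv/= => /andP[].
apply: (subclosed_compact _ cC); last by apply: subIsetl.
apply: closedI; first by apply: compact_closed.
apply: closedI.
  by apply: preimage_closed; [move=> x _; exact: fc|exact: closed_eq].
by apply: preimage_closed; [move=> x _; exact: gc|exact: closed_ge].
Qed.

(** Maximum-theorem argument: by uniqueness [ws] strictly beats each point of the compact set
    [Kset eta], the gap persists near that point and near the parameters, and compactness makes the
    parameter neighbourhood uniform. A maximizer there cannot lie in [Kset eta]. *)
Lemma maximizer_stable (eta : R) : 0 < eta ->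
  exists2 e, 0 < e & forall m c', (forall a, `|mu a - m a| < e) ->
    (forall a, `|c a - c' a| < e) ->
    [/\ is_best m a0, forall a, 0 < c' a &
     forall w, is_maximizer M d m c' w -> forall a, `|w a - ws a| < eta].
Proof.
move=> eta0.
pose F := filter_prod (unif_nbhs mu) (unif_nbhs c).
have FF : Filter F by exact: filter_prod_filter.
have c1 a : (fun p : ('I_K -> R) * ('I_K -> R) => p.1 a) @ F --> mu a.
  exact: (cvg_comp _ _ cvg_fst (@cvg_unif_nbhs _ _ mu a)).
have c2 a : (fun p : ('I_K -> R) * ('I_K -> R) => p.2 a) @ F --> c a.
  exact: (cvg_comp _ _ cvg_snd (@cvg_unif_nbhs _ _ c a)).
pose Q (p : ('I_K -> R) * ('I_K -> R)) (x : 'rV[R]_K) :=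
  (forall a, 0 <= x ord0 a) -> obj p.1 p.2 (fun a => x ord0 a) < obj p.1 p.2 ws.
have sws := proj1 ws_max.
have n1 : \forall p \near F, forall a, M (p.1 a) by exact: near_M.
have n2 : \forall p \near F, is_best p.1 a0 by exact: near_is_best.
have n3 : \forall p \near F, forall a, 0 < p.2 a by exact: near_pos.
have near_ws r : r < V -> \forall p \near F, r < obj p.1 p.2 ws.
  move=> rV; have rV2 : (r + V) / 2 < V by lra.
  have cv a : (fun p : ('I_K -> R) * ('I_K -> R) => ws a / p.2 a) @ F --> ws a / c a.
    by apply: cvgM; [exact: cvg_cst|apply: cvgV => //; rewrite gt_eqF].
  have n4 := @near_trans_cost _ F FF _ _ _ c1 cv rV2.
  apply: filterS4 n1 n2 n3 n4 => p Mm mb cp h.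
  apply: (@lt_le_trans _ _ ((r + V) / 2)); first by lra.
  apply: (ctas_obj_ge bd K_ge2 Mm mb) => //; first exact: (proj1 sws).
  by move=> b /h /ltW.
have cover : \forall p \near F, Kset eta `<=` Q p.
  have /compact_near_coveringP := @Kset_compact eta; apply => x [[x0 x1] xe].
  have xV : obj mu c (fun a => x ord0 a) < V.
    rewrite lt_neqAle (proj2 ws_max) // andbT; apply/eqP => e.
    have xmax : is_maximizer M d mu c (fun a => x ord0 a).
      by split => // w' sw'; rewrite e; exact: (proj2 ws_max).
    have := maximizer_uniq bd K_ge2 Mmu mu_a0 c_gt0 ws_max xmax => xw.
    move: xe => /=; rewrite big1 ?leNgt ?eta0 // => a _.
    by rewrite -xw subrr normr0.
  (* This level separates upper semicontinuity of the objective at [x] from its lower bound at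
     [ws]. *)
  pose r := (obj mu c (fun a => x ord0 a) + V) / 2.
  have r1 : obj mu c (fun a => x ord0 a) < r by rewrite /r; lra.
  have r2 : r < V by rewrite /r; lra.
  pose T := ('rV[R]_K * (('I_K -> R) * ('I_K -> R)))%type.
  have near1 : filter_prod (nbhs x) F (fun q : T =>
      (forall a, 0 <= q.1 ord0 a) -> obj q.2.1 q.2.2 (fun a => q.1 ord0 a) < r).
    have FN : Filter (nbhs x) := nbhs_filter x.
    apply: (@obj_usc (fun a => x ord0 a) r x0 r1 T (filter_prod (nbhs x) F) _
      (fun q => q.2.1) (fun q => q.2.2) (fun q a => q.1 ord0 a)).
    - by move=> a; apply: (cvg_comp _ _ cvg_snd (c1 a)).
    - by move=> a; apply: (cvg_comp _ _ cvg_snd (c2 a)).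
    - move=> a; move=> A /(@coord_continuous R _ _ ord0 a x) xA.
      exact: (@filter_prod1 _ _ (nbhs x) F FF _ xA).
  have near2 : filter_prod (nbhs x) F (fun q : T => r < obj q.2.1 q.2.2 ws).
    have FN : Filter (nbhs x) := nbhs_filter x.
    exact: (cvg_snd (near_ws r r2)).
  apply: filterS2 near1 near2 => -[y p] /= h1 h2 y0.
  exact: lt_trans (h1 y0) h2.
have [e e0 he] : exists2 e, 0 < e & forall m c', (forall a, `|mu a - m a| < e) ->
    (forall a, `|c a - c' a| < e) ->
    [/\ is_best m a0, forall a, 0 < c' a & Kset eta `<=` Q (m, c')].
  apply: (@unif_nbhs_prod _ _ mu c (fun p => [/\ is_best p.1 a0,
    forall a, 0 < p.2 a & Kset eta `<=` Q p])).
  by apply: filterS3 n2 n3 cover => p h1 h2 h3; split.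
exists e => // m c' hm hc; have [mb cp hK] := he m c' hm hc.
split => // w [sw wmax] a; rewrite ltNge; apply/negP => wa.
pose x : 'rV[R]_K := \row_a w a.
have xE : (fun a => x ord0 a) = w by apply/funext => b; rewrite mxE.
have Kx : Kset eta x.
  split; first by rewrite /= xE.
  rewrite /= (bigD1 a) //= mxE; apply: (le_trans wa); rewrite lerDl.
  exact: sumr_ge0.
have x_ge0 b : 0 <= x ord0 b by rewrite mxE; exact: (proj1 sw).
by have := hK x Kx x_ge0; rewrite /= xE ltNge wmax.
Qed.

End Stability.

(** * Sample paths of CTAS *)

Section Path.
Variables (R : realType) (K : nat) (K_ge2 : (2 <= K)%N).
Variables (wstar : ('I_K -> R) -> ('I_K -> R) -> ('I_K -> R)).
Variable sel : hist_t R K -> {set 'I_K} -> 'I_K.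
Hypothesis sel_in : forall hs (S : {set 'I_K}), (0 < #|S|)%N -> sel hs S \in S.
Variables (T : Type) (X C : 'I_K -> nat -> T -> R) (om : T).
Variable ell : R.
Hypothesis ell_gt0 : 0 < ell.
Hypothesis C_itv : forall a n, ell <= C a n om <= 1.

Local Notation H t := (ctas_hist wstar sel X C t om).
Local Notation N t a := (Npulls (H t) a).
Local Notation W t a := (Csum (H t) a).
Local Notation J t := (Jcost (H t)).
Local Notation A t := (ctas_next wstar sel (H t)).

Lemma Npulls_rcons (hs : hist_t R K) b x y a :
  Npulls (rcons hs (b, x, y)) a = (Npulls hs a + (b == a))%N.
Proof. by rewrite /Npulls -cats1 count_cat /= addn0. Qed.

Lemma N_S t a : N t.+1 a = (N t a + (A t == a))%N.
Proof. exact: Npulls_rcons. Qed.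

Lemma size_hist t : size (H t) = t.
Proof. by elim: t => //= t ih; rewrite size_rcons ih. Qed.

Lemma Csum_S t a : W t.+1 a = W t a + (A t == a)%:R * C a (N t a) om.
Proof.
rewrite /Csum /= big_rcons /=; case: eqP => [->|_] /=; first by rewrite mul1r.
by rewrite mul0r addr0.
Qed.

(** Each pull consumes the next entry of the stack of the arm, so the observed rewards form a prefix
    of it. *)
Lemma SsumE t a : Ssum (H t) a = \sum_(i < N t a) X a i om.
Proof.
elim: t => [|t ih]; first by rewrite /Ssum big_nil big_ord0.
rewrite N_S /Ssum /= big_rcons /= -/(Ssum (H t) a) ih.
case: eqP => [->|_] /=; last by rewrite addn0 addr0.
by rewrite addn1 big_ord_recr.
Qed.

Lemma CsumE t a : W t a = \sum_(i < N t a) C a i om.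
Proof.
elim: t => [|t ih]; first by rewrite /Csum big_nil big_ord0.
rewrite N_S Csum_S ih.
case: eqP => [_|_] /=; last by rewrite addn0 mul0r addr0.
by rewrite addn1 big_ord_recr /= mul1r.
Qed.

Lemma JcostE t : J t = \sum_a W t a.
Proof.
elim: t => [|t ih].
  by rewrite /Jcost /= big_nil big1 // => a _; rewrite /Csum big_nil.
rewrite /Jcost /= big_rcons /= -/(Jcost (H t)) ih.
under [RHS]eq_bigr do rewrite Csum_S.
rewrite big_split /=; congr (_ + _).
rewrite (bigD1 (A t)) //= eqxx mul1r big1 ?addr0 // => a.
by rewrite eq_sym => /negPf ->; rewrite mul0r.
Qed.

Lemma Jcost_S t : J t.+1 = J t + C (A t) (N t (A t)) om.
Proof. by rewrite /Jcost /= big_rcons. Qed.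

Lemma Jcost_ge t : ell * t%:R <= J t.
Proof.
elim: t => [|t ih]; first by rewrite mulr0 /Jcost big_nil.
rewrite Jcost_S -natr1 mulrDr mulr1 lerD //.
by have /andP[] := C_itv (A t) (N t (A t)).
Qed.

Lemma Jcost_le t : J t <= t%:R.
Proof.
elim: t => [|t ih]; first by rewrite /Jcost big_nil.
rewrite Jcost_S -natr1 lerD //.
by have /andP[] := C_itv (A t) (N t (A t)).
Qed.

Lemma Jcost_S_le t : J t.+1 <= J t + 1.
Proof. by rewrite Jcost_S lerD2l; have /andP[] := C_itv (A t) (N t (A t)). Qed.

Lemma Jcost_leS t : J t <= J t.+1.
Proof.
rewrite Jcost_S lerDl; have /andP[h _] := C_itv (A t) (N t (A t)).
exact: le_trans (ltW ell_gt0) h.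
Qed.

Lemma Csum_leN t a : W t a <= (N t a)%:R.
Proof.
rewrite CsumE -[X in _ <= X%:R]card_ord -sumr_const.
by apply: ler_sum => i _; have /andP[] := C_itv a i.
Qed.

Lemma Csum_geN t a : ell * (N t a)%:R <= W t a.
Proof.
rewrite CsumE mulr_natr -[X in _ *+ X <= _]card_ord -sumr_const.
by apply: ler_sum => i _; have /andP[] := C_itv a i.
Qed.

Lemma N_le t a : (N t a <= t)%N.
Proof. by rewrite -[X in (_ <= X)%N]size_hist; exact: count_size. Qed.

Lemma N_leS t a : (N t a <= N t.+1 a)%N.
Proof. by rewrite N_S leq_addr. Qed.

Lemma N_mono s t a : (s <= t)%N -> (N s a <= N t a)%N.
Proof. by move=> /subnK <-; elim: (t - s)%N => // n ih; rewrite (leq_trans ih) // addSn N_leS. Qed.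

Lemma argmin_nonempty (f : 'I_K -> nat) : (0 < #|finset (fun a => [forall b, (f a <= f b)%N])|)%N.
Proof.
apply/card_gt0P; have K0 : (0 < K)%N by exact: leq_trans K_ge2.
have [a _ ha] := @arg_minnP _ (Ordinal K0) xpredT f isT.
by exists a; rewrite inE; apply/forallP => b; exact: ha.
Qed.

Lemma argmax_nonempty (f : 'I_K -> R) : (0 < #|finset (fun a => [forall b, (f b <= f a)%R])|)%N.
Proof.
apply/card_gt0P; have K0 : (0 < K)%N by exact: leq_trans K_ge2.
have [a _ ha] := @arg_maxP _ _ _ (Ordinal K0) xpredT f isT.
by exists a; rewrite inE; apply/forallP => b; exact: ha.
Qed.

(** The initial round-robin obeys the same rule, an unpulled arm having minimal count. *)
Lemma forced_pull t b : (N t b)%:R < Num.sqrt (t%:R : R) -> forall a, (N t (A t) <= N t a)%N.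
Proof.
move=> hb a; rewrite /ctas_next; case: pickP => [a' /eqP -> //|_].
rewrite size_hist; case: ifPn => [_|/existsP[]]; last by exists b.
by have := sel_in (H t) (argmin_nonempty (fun a => N t a)); rewrite inE => /forallP.
Qed.

Lemma free_pull t : (forall a, (0 < N t a)%N) -> (forall b, Num.sqrt (t%:R : R) <= (N t b)%:R) ->
  let w := wstar (muhat (H t)) (chat (H t)) in
  forall b, J t * w b - W t b <= J t * w (A t) - W t (A t).
Proof.
move=> N0 hN w b.
have chE a : chat (H t) a * (N t a)%:R = W t a.
  by rewrite /chat divfK // pnatr_eq0 -lt0n.
rewrite -!chE {1 2 3}/ctas_next.
case: pickP => [a' /eqP e|_]; first by have := N0 a'; rewrite e.
rewrite size_hist; case: ifPn => [/existsP[a']|_]; first by rewrite ltNge hN.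
have := sel_in (H t) (argmax_nonempty
  (fun a => J t * w a - chat (H t) a * (N t a)%:R)).
by rewrite inE => /forallP.
Qed.

(* Every round [s >= n^2] at which some arm has fewer than [n] pulls is forced, and increases [\sum_a minn (N s a) n] by one. *)
Lemma exploration n t : (n ^ 2 + K * n <= t)%N -> forall a, (n <= N t a)%N.
Proof.
move=> nt a; rewrite leqNgt; apply/negP => Na.
pose phi s := (\sum_a minn (N s a) n)%N.
have phi_lt : (phi t < K * n)%N.
  rewrite /phi (bigD1 a) //= -[X in (X * n)%N](card_ord K) -sum_nat_const.
  rewrite [ltnRHS](bigD1 a) //= -addSn leq_add //; first by rewrite gtn_min Na.
  by apply: leq_sum => b _; exact: geq_minr.
have step s : (n ^ 2 <= s)%N -> (s < t)%N -> (phi s.+1 = (phi s).+1)%N.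
  move=> ns st.
  have Ns : (N s a < n)%N by apply: leq_ltn_trans Na; apply: N_mono; exact: ltnW.
  have forced : (N s a)%:R < Num.sqrt (s%:R : R).
    apply: (@lt_le_trans _ _ n%:R); first by rewrite ltr_nat.
    rewrite -[leLHS]ger0_norm // -sqrtr_sqr ler_sqrt ?ler0n //.
    by rewrite -natrX ler_nat.
  have NA : (N s (A s) < n)%N by apply: leq_ltn_trans Ns; exact: forced_pull forced a.
  rewrite /phi (bigD1 (A s)) //= [in RHS](bigD1 (A s)) //= N_S eqxx addn1 -addSn.
  congr (_ + _)%N; first by rewrite (minn_idPl NA) (minn_idPl (ltnW NA)).
  by apply: eq_bigr => b; rewrite N_S eq_sym => /negPf ->; rewrite addn0.
have grow k : (n ^ 2 + k <= t)%N -> (k <= phi (n ^ 2 + k)%N)%N.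
  elim: k => // k ih; rewrite addnS => kt; rewrite step ?leq_addr //.
  by rewrite ltnS; apply: ih; exact: ltnW.
have := grow (t - n ^ 2)%N; rewrite subnKC; last by apply: leq_trans nt; exact: leq_addr.
move=> /(_ (leqnn _)) h.
have : (K * n <= t - n ^ 2)%N by rewrite leq_subRL //; apply: leq_trans nt; exact: leq_addr.
by move=> /leq_trans /(_ h); rewrite leqNgt phi_lt.
Qed.

End Path.

Section Tracking.
Variables (R : realType) (K : nat) (K_ge2 : (2 <= K)%N).
Variables (wstar : ('I_K -> R) -> ('I_K -> R) -> ('I_K -> R)).
Variable sel : hist_t R K -> {set 'I_K} -> 'I_K.
Hypothesis sel_in : forall hs (S : {set 'I_K}), (0 < #|S|)%N -> sel hs S \in S.
Variables (T : Type) (X C : 'I_K -> nat -> T -> R) (om : T).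
Variable ell : R.
Hypothesis ell_gt0 : 0 < ell.
Hypothesis C_itv : forall a n, ell <= C a n om <= 1.

Local Notation H t := (ctas_hist wstar sel X C t om).
Local Notation N t a := (Npulls (H t) a).
Local Notation W t a := (Csum (H t) a).
Local Notation J t := (Jcost (H t)).
Local Notation A t := (ctas_next wstar sel (H t)).
Local Notation what t := (wstar (muhat (H t)) (chat (H t))).

Lemma Jcost_ge0 t : 0 <= J t.
Proof. by apply: le_trans (Jcost_ge _ _ _ C_itv t); rewrite mulr_ge0 // ltW. Qed.

(* When arm [a] is pulled at an unforced round, its score is at least the average score, which is [0]. *)
Lemma tracking t1 (u : 'I_K -> R) :
  (forall a, 0 <= u a) -> (forall a, (0 < N t1 a)%N) ->
  (forall t, (t1 <= t)%N -> \sum_a what t a = 1 /\ forall a, what t a <= u a) ->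
  forall t, (t1 <= t)%N -> forall a,
    W t a <= J t * u a + Num.sqrt (t%:R : R) + 1 + t1%:R.
Proof.
move=> u0 N1 hw t /subnK <-; elim: (t - t1)%N => [|k ih] a.
  rewrite add0n; apply: (@le_trans _ _ t1%:R).
    by apply: (le_trans (Csum_leN wstar sel X C_itv t1 a)); rewrite ler_nat N_le.
  by rewrite lerDr !addr_ge0 ?mulr_ge0 ?sqrtr_ge0 ?Jcost_ge0.
rewrite addSn; move: (k + t1)%N (leq_addl k t1) ih => {t} {}t t1t ih.
have N0 b : (0 < N t b)%N by exact: leq_trans (N1 b) (N_mono _ _ _ _ _ _ t1t).
have JS := Jcost_leS wstar sel X ell_gt0 C_itv t.
have sS : Num.sqrt (t%:R : R) <= Num.sqrt (t.+1%:R : R) by rewrite ler_wsqrtr ?ler_nat.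
have JuS : J t * u a <= J t.+1 * u a by rewrite ler_wpM2r.
rewrite Csum_S; case: eqP => [Aa|_]; last first.
  by rewrite mul0r addr0; have := ih a; lra.
have C1 : C a (N t a) om <= 1 by have /andP[] := C_itv a (N t a).
have t1_0 : 0 <= t1%:R :> R by [].
have s0 : 0 <= Num.sqrt (t%:R : R) by rewrite sqrtr_ge0.
have Ju0 : 0 <= J t * u a by rewrite mulr_ge0 ?Jcost_ge0.
suff : W t a <= J t * u a + Num.sqrt (t%:R : R) by rewrite mul1r; lra.
(* At a forced round the pulled arm has minimal count, so its cost is at most its count, hence below
   [sqrt t]. *)
have [/existsP[b hb]|] := boolP [exists b, (N t b)%:R < Num.sqrt (t%:R : R)].
  have := forced_pull K_ge2 sel_in hb b; rewrite Aa -(ler_nat R) => Nab.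
  have := Csum_leN wstar sel X C_itv t a; lra.
move=> /existsPn hb.
have hb' b : Num.sqrt (t%:R : R) <= (N t b)%:R by rewrite leNgt; exact: hb.
have := free_pull K_ge2 sel_in N0 hb'; rewrite Aa => free.
have [w1 wu] := hw t t1t.
have : \sum_b (J t * what t b - W t b) <= \sum_(b < K) (J t * what t a - W t a).
  by apply: ler_sum => b _; exact: free.
rewrite sumrB -mulr_sumr w1 mulr1 -JcostE subrr sumr_const card_ord.
rewrite pmulrn_lge0; last exact: leq_trans K_ge2.
have : J t * what t a <= J t * u a by rewrite ler_wpM2l ?Jcost_ge0.
lra.
Qed.

(** The constant [A] is such that [t / A] bounds both [sqrt t] and [t1 + 1], while
    [3 t / A = eta ell t <= eta J]; the sublinear error of [tracking] is absorbed by a second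
    [eta]. *)
Lemma tracking_late t1 (w : 'I_K -> R) (eta : R) : 0 < eta ->
  (forall a, 0 <= w a) -> (forall a, (0 < N t1 a)%N) ->
  (forall t, (t1 <= t)%N -> \sum_a what t a = 1 /\ forall a, what t a <= w a + eta) ->
  forall t, (t1 <= t)%N ->
  let A := 3 / (eta * ell) in A * t1%:R + A + A ^+ 2 <= t%:R ->
  forall a, W t a <= J t * (w a + 2 * eta).
Proof.
move=> eta0 w0 N1 hw t t1t A tA a.
have u0 b : 0 <= w b + eta by rewrite addr_ge0 // ltW.
apply: (le_trans (tracking u0 N1 hw t1t a)).
have ee : 0 < eta * ell by rewrite mulr_gt0.
have A0 : 0 < A by rewrite divr_gt0.
have t1_0 : 0 <= t1%:R :> R by [].
have s2 : Num.sqrt (t%:R : R) ^+ 2 = t%:R by rewrite sqr_sqrtr.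
have s0 : 0 <= Num.sqrt (t%:R : R) by rewrite sqrtr_ge0.
have As : A * Num.sqrt (t%:R : R) <= t%:R.
  apply: (@le_trans _ _ (Num.sqrt (t%:R : R) ^+ 2)); last by rewrite s2.
  rewrite expr2 ler_wpM2r // -ler_sqr ?nnegrE ?(ltW A0) // s2.
  apply: le_trans tA; rewrite lerDr; apply: addr_ge0; last exact: ltW.
  by apply: mulr_ge0 => //; exact: ltW.
have At : A * (t1%:R + 1) <= t%:R.
  by apply: le_trans tA; rewrite mulrDr mulr1 lerDl sqr_ge0.
have Jt : ell * t%:R <= J t by exact: Jcost_ge C_itv t.
have JtA : 3 * (t%:R / A) <= eta * J t.
  have -> : 3 * (t%:R / A) = eta * (ell * t%:R).
    by rewrite /A; field; rewrite !gt_eqF.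
  by rewrite ler_pM2l.
have : Num.sqrt (t%:R : R) <= t%:R / A by rewrite ler_pdivlMr // mulrC.
have : t1%:R + 1 <= t%:R / A by rewrite ler_pdivlMr // mulrC.
have : 0 <= t%:R / A by rewrite divr_ge0 // ltW.
have -> : J t * (w a + 2 * eta) = J t * (w a + eta) + eta * J t by ring.
lra.
Qed.

End Tracking.

(** Both vectors sum to 1, so a deficit at one arm equals the total excess at the others: one-sided
    bounds become two-sided at the price of a factor [K]. *)
Lemma simplex_close (R : realType) (K : nat) (w p : 'I_K -> R) (e : R) :
  \sum_a w a = 1 -> \sum_a p a = 1 -> 0 <= e -> (forall a, p a <= w a + e) ->
  forall a, `|w a - p a| <= K%:R * e.
Proof.
move=> w1 p1 e0 pw a; have K1 : 1 <= K%:R :> R.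
  by rewrite ler1n; exact: leq_ltn_trans (leq0n a) (ltn_ord a).
rewrite ler_norml; apply/andP; split.
  have := pw a; have : e <= K%:R * e by rewrite ler_peMl.
  lra.
have : \sum_(b | b != a) p b <= \sum_(b | b != a) (w b + e).
  by apply: ler_sum => b _.
have : \sum_(b | b != a) (w b + e) <= \sum_(b | b != a) w b + K%:R * e.
  rewrite big_split /= lerD2l -[X in X%:R * _](card_ord K) mulr_natl -sumr_const.
  by rewrite [leRHS](bigD1 a) //= lerDr.
move: w1 p1; rewrite (bigD1 a) //= [\sum_a0 p a0](bigD1 a) //=.
lra.
Qed.

Lemma ratio_close (R : realType) (w p c c' ell e1 e2 : R) :
  0 < ell -> ell <= c -> ell <= c' -> 0 <= w <= 1 ->
  `|w - p| <= e1 -> `|c - c'| <= e2 ->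
  `|w / c - p / c'| <= e1 / ell + e2 / ell ^+ 2.
Proof.
move=> l0 lc lc' /andP[w0 w1] h1 h2.
have c0 : 0 < c by lra.
have c0' : 0 < c' by lra.
have -> : w / c - p / c' = (w - p) / c' + w * (c' - c) / (c * c').
  by field; rewrite !gt_eqF.
have e10 : 0 <= e1 by exact: le_trans h1.
have e20 : 0 <= e2 by exact: le_trans h2.
apply: (le_trans (ler_normD _ _)); apply: lerD.
  rewrite normrM normfV (gtr0_norm c0').
  by apply: ler_pM => //; [rewrite invr_ge0 ltW|rewrite lef_pV2 ?posrE].
rewrite !normrM normfV (gtr0_norm (mulr_gt0 c0 c0')) distrC (ger0_norm w0).
apply: ler_pM.
- by rewrite mulr_ge0.
- by rewrite invr_ge0 ltW // mulr_gt0.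
- by rewrite -[e2]mul1r ler_pM.
- by rewrite lef_pV2 ?posrE ?mulr_gt0 ?exprn_gt0 // expr2 ler_pM // ltW.
Qed.

(** This is [ln y <= y - 1] at [y = t e / alpha]. *)
Lemma ln_le_affine (R : realType) (alpha e : R) : 0 < alpha -> 0 < e ->
  exists D, forall t, 0 < t -> alpha * ln t <= e * t + D.
Proof.
move=> a0 e0; exists (- (alpha * ln (e / alpha))) => t t0.
have ea : 0 < e / alpha by rewrite divr_gt0.
rewrite lerBrDr -mulrDr -lnM ?posrE // mulrC -ler_pdivlMr //.
have -> : e * t / alpha = t * (e / alpha) by ring.
have := @le_ln1Dx R (t * (e / alpha) - 1); rewrite addrCA subrr addr0 => h.
have : ln (t * (e / alpha)) <= t * (e / alpha) - 1.
  by apply: h; have := mulr_gt0 t0 ea; lra.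
lra.
Qed.

Lemma betaE (R : realType) (B alpha : R) (t : nat) (delta : R) :
  0 < B -> (0 < t)%N -> 0 < delta ->
  beta B alpha t delta = ln B + alpha * ln t%:R + ln delta^-1.
Proof.
move=> B0 t0 d0; rewrite /beta.
have tp : 0 < t%:R `^ alpha :> R by rewrite powR_gt0 // ltr0n.
by rewrite !lnM ?posrE ?mulr_gt0 ?invr_gt0 // ln_powR.
Qed.

(** * Growth of the statistic on good paths and the cost at stopping *)

Section StoppingCost.
Variables (R : realType) (M : set R) (d : R -> R -> R) (th bb : R -> R).
Hypothesis bd : bregman_divergence M d th bb.
Variables (K : nat) (K_ge2 : (2 <= K)%N).
Variables (mu c : 'I_K -> R) (a0 : 'I_K).
Hypothesis Mmu : forall a, M (mu a).
Hypothesis mu_a0 : is_best mu a0.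
Variable ell : R.
Hypothesis ell_gt0 : 0 < ell.
Hypothesis c_ge : forall a, ell <= c a.
Variable wstar : ('I_K -> R) -> ('I_K -> R) -> ('I_K -> R).
Hypothesis wstar_max : forall m c', (exists a, is_best m a) -> (forall a, 0 < c' a) ->
  is_maximizer M d m c' (wstar m c').
Variable sel : hist_t R K -> {set 'I_K} -> 'I_K.
Hypothesis sel_in : forall hs (S : {set 'I_K}), (0 < #|S|)%N -> sel hs S \in S.
Variables alpha B : R.
Hypothesis alpha_gt0 : 0 < alpha.
Hypothesis B_gt0 : 0 < B.
Local Notation ws := (wstar mu c).
Local Notation V := (ctas_obj M d mu c ws).

Lemma Zstat_gt hs (r : R) :
  (forall b, b != a0 -> r < Zab d hs a0 b) -> (r%:E < Zstat d hs)%E.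
Proof.
move=> hr; apply: (@lt_le_trans _ _ (\big[Order.min/+oo%E]_(b | b != a0) (Zab d hs a0 b)%:E)%E).
  by apply: lt_bigmin; [exact: ltry|move=> b hb; rewrite lte_fin hr].
exact: (le_bigmax _ (fun a => \big[Order.min/+oo%E]_(b | b != a) (Zab d hs a b)%:E)%E).
Qed.

(** Here [n] counts samples of a stack and is not a round, so the event does not involve the
    algorithm. *)
Definition means_within (T : Type) (X C : 'I_K -> nat -> T -> R) (om : T) (xi : R) (n : nat) :=
  forall a, `|mu a - (\sum_(i < n) X a i om) / n%:R| < xi /\
            `|c a - (\sum_(i < n) C a i om) / n%:R| < xi.

Lemma Zstat_late (r : R) : 0 < r -> r < V ->
  exists xi A : R, [/\ 0 < xi, 0 < A &
  forall (T : Type) (X C : 'I_K -> nat -> T -> R) (om : T),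
  (forall a n, ell <= C a n om <= 1) ->
  forall n0, (0 < n0)%N -> (forall n, (n0 <= n)%N -> means_within X C om xi n) ->
  forall t, (n0 ^ 2 + K * n0 <= t)%N ->
    A * (n0 ^ 2 + K * n0)%:R + A + A ^+ 2 <= t%:R ->
    ((Jcost (ctas_hist wstar sel X C t om) * r)%:E <
       Zstat d (ctas_hist wstar sel X C t om))%E ].
Proof.
move=> r0 rV.
have c_gt0 a : 0 < c a by exact: lt_le_trans (c_ge a).
have ws_max : is_maximizer M d mu c ws by apply: wstar_max => //; exists a0.
have [[w0 w1] _] := ws_max.
have [e3 e30 stab] := trans_cost_stable bd K_ge2 Mmu mu_a0 c_gt0 ws_max rV.
have Kp : 0 < K%:R :> R by rewrite ltr0n; exact: leq_trans K_ge2.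
(* The tolerance [e3] on [N_a / J] is split by [ratio_close]: tracking contributes
   [K (2 eta) / ell = e3 / 3], and the error [xi <= e5] on the cost means contributes at most
   [e5 / ell ^ 2 = e3 / 3]. *)
pose eta := e3 * ell / (6 * K%:R).
have eta0 : 0 < eta by rewrite divr_gt0 ?mulr_gt0.
have [e4 e40 mstab] := maximizer_stable bd K_ge2 Mmu mu_a0 c_gt0 ws_max eta0.
pose e5 := e3 * ell ^+ 2 / 3.
have e50 : 0 < e5 by rewrite divr_gt0 ?mulr_gt0 ?exprn_gt0.
pose xi := Num.min e3 (Num.min e4 e5).
have xi0 : 0 < xi by rewrite !lt_min e30 e40 e50.
have xi3 : xi <= e3 by rewrite ge_min lexx.
have xi4 : xi <= e4 by rewrite !ge_min lexx orbT.
have xi5 : xi <= e5 by rewrite !ge_min lexx !orbT.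
have ee : 0 < eta * ell by exact: mulr_gt0.
have A0 : 0 < 3 / (eta * ell) by exact: divr_gt0.
exists xi, (3 / (eta * ell)); split => //.
move=> T X C om C_itv n0 n0_gt0 good t t1t tA.
set H := fun t => ctas_hist wstar sel X C t om.
have Ntn s a : (n0 ^ 2 + K * n0 <= s)%N -> (n0 <= Npulls (H s) a)%N.
  by move=> hs; exact: (exploration K_ge2 wstar sel_in X C om hs).
have gd s : (n0 ^ 2 + K * n0 <= s)%N ->
   (forall a, `|mu a - muhat (H s) a| < xi) /\ (forall a, `|c a - chat (H s) a| < xi).
  move=> hs; split=> a; have [h1 h2] := good _ (Ntn s a hs) a.
    by rewrite /muhat SsumE.
  by rewrite /chat CsumE.
have Np s a : (n0 ^ 2 + K * n0 <= s)%N -> (0 < Npulls (H s) a)%N.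
  by move=> hs; apply: leq_trans (Ntn s a hs).
have what_close s : (n0 ^ 2 + K * n0 <= s)%N ->
    simplex (wstar (muhat (H s)) (chat (H s))) /\
    forall a, wstar (muhat (H s)) (chat (H s)) a <= ws a + eta.
  move=> hs; have [g1 g2] := gd s hs.
  have [|| best pos close] := mstab (muhat (H s)) (chat (H s)).
  - by move=> a; exact: lt_le_trans (g1 a) xi4.
  - by move=> a; exact: lt_le_trans (g2 a) xi4.
  have wm : is_maximizer M d (muhat (H s)) (chat (H s)) (wstar (muhat (H s)) (chat (H s))).
    by apply: wstar_max => //; exists a0.
  split; first exact: (proj1 wm).
  move=> a; have := close _ wm a; rewrite ltr_norml => /andP[_ h]; lra.
have track := @tracking_late R K K_ge2 wstar sel sel_in T X C om ell ell_gt0 C_itv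
  (n0 ^ 2 + K * n0)%N ws eta eta0 w0 (fun a => Np _ a (leqnn _)).
have {}track : forall a, Csum (H t) a <= Jcost (H t) * (ws a + 2 * eta).
  apply: track t t1t tA => s hs; have [[_ s1] s2] := what_close s hs; by split.
have tpos : (0 < t)%N.
  by apply: leq_trans t1t; rewrite addn_gt0 expn_gt0 n0_gt0.
have Jp : 0 < Jcost (H t).
  by apply: lt_le_trans (Jcost_ge _ _ _ C_itv t); rewrite mulr_gt0 // ltr0n.
(* The share of the total cost spent on [a]; tracking bounds it from above only. Below, [v a] is the
   number of pulls per unit of cost, equal to [p a / chat a]. *)
pose p a := Csum (H t) a / Jcost (H t).
have p1 : \sum_a p a = 1 by rewrite -mulr_suml -JcostE divff // gt_eqF.
have pw a : p a <= ws a + 2 * eta by rewrite ler_pdivrMr // mulrC.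
have eta2 : 0 <= 2 * eta by lra.
have close := simplex_close w1 p1 eta2 pw.
pose v a := (Npulls (H t) a)%:R / Jcost (H t).
have Ntp a : 0 < (Npulls (H t) a)%:R :> R by rewrite ltr0n; exact: Np.
have chat_ge a : ell <= chat (H t) a.
  by rewrite /chat ler_pdivlMr //; exact: Csum_geN.
have vE a : v a = p a / chat (H t) a.
  have Cn0 : Csum (H t) a != 0.
    rewrite gt_eqF //; apply: lt_le_trans (Csum_geN wstar sel X C_itv t a).
    by rewrite mulr_gt0.
  rewrite /v /p /chat; field.
  by rewrite Cn0 !gt_eqF.
have [g1 g2] := gd t t1t.
have vclose a : `|ws a / c a - v a| < e3.
  have w01 : 0 <= ws a <= 1.
    rewrite w0 -w1 (bigD1 a) //= lerDl; exact: sumr_ge0.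
  rewrite vE; apply: le_lt_trans
    (ratio_close ell_gt0 (c_ge a) (chat_ge a) w01 (close a) (ltW (g2 a))) _.
  have -> : K%:R * (2 * eta) / ell = e3 / 3.
    by rewrite /eta; field; rewrite !gt_eqF.
  have : xi / ell ^+ 2 <= e3 / 3.
    rewrite ler_pdivrMr ?exprn_gt0 //; apply: (le_trans xi5).
    by rewrite /e5; lra.
  lra.
have [|Mm hG] := stab (muhat (H t)) v _ vclose.
  by move=> a; exact: lt_le_trans (g1 a) xi3.
apply: Zstat_gt => b hb.
have -> : Zab d (H t) a0 b = trans_cost d (Npulls (H t) a0)%:R (Npulls (H t) b)%:R
    (muhat (H t) a0) (muhat (H t) b) by [].
have NE a : (Npulls (H t) a)%:R = Jcost (H t) * v a.
  by rewrite /v mulrC divfK // gt_eqF.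
rewrite !NE trans_costZ ?gt_eqF // ltr_pM2l //; exact: hG.
Qed.

Lemma J_tau_le (r' : R) : 0 < r' -> r' < V ->
  exists xi D : R, [/\ 0 < xi, 0 <= D &
  forall (T : Type) (X C : 'I_K -> nat -> T -> R) (om : T),
  (forall a n, ell <= C a n om <= 1) ->
  forall n0, (0 < n0)%N -> (forall n, (n0 <= n)%N -> means_within X C om xi n) ->
  forall delta, 0 < delta < 1 ->
  (J_tau d wstar sel X C B alpha delta om <=
    (ln delta^-1 / r' + D * (n0 ^ 2)%:R)%:E)%E ].
Proof.
move=> r'0 r'V; pose r := (r' + V) / 2.
have rr' : r' < r by rewrite /r; lra.
have rV : r < V by rewrite /r; lra.
have r0 : 0 < r by lra.
have [xi [A [xi0 A0 late]]] := Zstat_late r0 rV.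
(* With this slope, [alpha ln t <= (r - r') ell t + C2 <= (r - r') J + C2]: the gap between the two
   rates pays for the growth of the threshold. *)
have e0 : 0 < (r - r') * ell by rewrite mulr_gt0 // subr_gt0.
have [C2 hC2] := ln_le_affine alpha_gt0 e0.
pose C1 := `|ln B + C2|.
have C10 : 0 <= C1 by rewrite /C1.
(* In order: the constant part of the threshold, the waiting time [x2] of tracking, the exploration
   time [t1 <= (K + 1) n0 ^ 2], and the cost of the stopping round. *)
pose D := C1 / r' + A * (K.+1)%:R + A + A ^+ 2 + K.+1%:R + 1.
have D0 : 0 <= D by rewrite /D !addr_ge0 ?divr_ge0 ?mulr_ge0 ?sqr_ge0 // ltW.
exists xi, D; split => // T X C om C_itv n0 n0_gt0 good delta /andP[d0 d1].
have L0 : 0 <= ln delta^-1 by rewrite ln_ge0 // invf_ge1 // ltW.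
set t1 := (n0 ^ 2 + K * n0)%N.
have t1K : (K <= t1)%N.
  by rewrite /t1 -[X in (X <= _)%N]muln1 (leq_trans _ (leq_addl _ _)) // leq_mul.
pose x2 := A * t1%:R + A + A ^+ 2.
have stopP t : (t1 <= t)%N -> x2 <= t%:R ->
    ln delta^-1 + C1 <= Jcost (ctas_hist wstar sel X C t om) * r' ->
    stops d wstar sel X C B alpha delta om t.
  move=> t1t xt Jr; rewrite /stops (leq_trans t1K t1t) /=.
  apply: le_lt_trans (late _ _ _ _ C_itv _ n0_gt0 good _ t1t xt).
  have tp : (0 < t)%N by apply: leq_trans t1t; apply: leq_trans t1K; exact: leq_trans K_ge2.
  rewrite lee_fin betaE //.
  have := hC2 t%:R; rewrite ltr0n => /(_ tp) h2.
  have Jt : ell * t%:R <= Jcost (ctas_hist wstar sel X C t om) by exact: Jcost_ge.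
  have : (r - r') * (ell * t%:R) <= (r - r') * Jcost (ctas_hist wstar sel X C t om).
    by rewrite ler_pM2l // subr_gt0.
  have : ln B + C2 <= C1 by exact: ler_norm.
  move: Jr h2; move: (Jcost _) (ln delta^-1) (ln t%:R) (ln B) => Jv L lt lB.
  rewrite mulrA => ? ? ? ?.
  have -> : Jv * r = Jv * r' + (r - r') * Jv by ring.
  lra.
have ex : exists t, stops d wstar sel X C B alpha delta om t.
  pose x3 := (ln delta^-1 + C1) / (r' * ell).
  pose t := (t1 + (Num.bound `|x2| + Num.bound `|x3|))%N.
  have b2 : x2 <= (Num.bound `|x2|)%:R.
    by apply: (le_trans (ler_norm _)); apply: ltW; apply: archi_boundP.
  have b3 : x3 <= (Num.bound `|x3|)%:R.
    by apply: (le_trans (ler_norm _)); apply: ltW; apply: archi_boundP.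
  exists t; apply: stopP; first exact: leq_addr.
    apply: (le_trans b2); rewrite ler_nat /t addnCA; exact: leq_addr.
  have : x3 <= t%:R.
    by apply: (le_trans b3); rewrite ler_nat /t addnA; exact: leq_addl.
  rewrite ler_pdivrMr ?mulr_gt0 // => h; apply: (le_trans h).
  rewrite mulrCA mulrC ler_wpM2r ?(ltW r'0) // mulrC.
  exact: Jcost_ge.
rewrite /J_tau; case: pselect => // ex'; rewrite lee_fin.
case: ex_minnP => tau _ tau_min.
have n1 : 1 <= (n0 ^ 2)%:R :> R by rewrite ler1n expn_gt0 n0_gt0.
have t1le : t1%:R <= K.+1%:R * (n0 ^ 2)%:R :> R.
  rewrite -natrM ler_nat /t1 mulSn leq_add2l leq_mul2l expnS expn1 leq_pmulr ?orbT //.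
have LR : 0 <= ln delta^-1 / r' by rewrite divr_ge0 // ltW.
have Dn y : y <= C1 / r' + (A * K.+1%:R + A + A ^+ 2 + K.+1%:R) * (n0 ^ 2)%:R + 1 ->
    y <= D * (n0 ^ 2)%:R.
  move=> hy; apply: (le_trans hy).
  have : C1 / r' <= C1 / r' * (n0 ^ 2)%:R by rewrite ler_peMr // divr_ge0 // ltW.
  rewrite /D; lra.
have K1 : 0 <= K.+1%:R :> R by [].
have A2 : 0 <= A ^+ 2 by exact: sqr_ge0.
have C1r : 0 <= C1 / r' by rewrite divr_ge0 // ltW.
have A1 : A <= A * (n0 ^ 2)%:R by rewrite ler_peMr // ltW.
have A21 : A ^+ 2 <= A ^+ 2 * (n0 ^ 2)%:R by rewrite ler_peMr.
have K11 : 0 <= K.+1%:R * (n0 ^ 2)%:R :> R by rewrite mulr_ge0.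
have At1 : A * t1%:R <= A * (K.+1%:R * (n0 ^ 2)%:R) by rewrite ler_pM2l.
have AK : 0 <= A * K.+1%:R * (n0 ^ 2)%:R by rewrite !mulr_ge0 // ltW.
(* By minimality round [s] does not stop, so one of the three conditions of [stopP] fails there;
   whichever fails bounds the cost. *)
case: tau tau_min => [|s] tau_min.
  have -> : Jcost (ctas_hist wstar sel X C 0 om) = 0 by rewrite /Jcost big_nil.
  by rewrite addr_ge0 // mulr_ge0.
have Js : Jcost (ctas_hist wstar sel X C s.+1 om) <= s%:R + 1.
  by rewrite natr1; exact: Jcost_le.
case: (leqP t1 s) => st1; last first.
  apply: ler_wpDl => //; apply: Dn; apply: (le_trans Js); rewrite natr1.
  apply: (@le_trans _ _ t1%:R); first by rewrite ler_nat.
  lra.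
case: (lerP x2 s%:R) => sx2; last first.
  apply: ler_wpDl => //; apply: Dn; apply: (le_trans Js).
  move: sx2; rewrite /x2; lra.
case: (lerP (ln delta^-1 + C1) (Jcost (ctas_hist wstar sel X C s om) * r')) => hs.
  by have := tau_min s (stopP s st1 sx2 hs); rewrite ltnn.
have Js1 := Jcost_S_le wstar sel X C_itv s.
apply: (le_trans Js1).
move: hs; rewrite -ltr_pdivlMr // mulrDl => hs.
have -> : D * (n0 ^ 2)%:R = (D * (n0 ^ 2)%:R - (C1 / r' + 1)) + (C1 / r' + 1) by ring.
have : C1 / r' + 1 <= D * (n0 ^ 2)%:R by apply: Dn; lra.
lra.
Qed.

End StoppingCost.

(** * Deviation probabilities *)

Section Disintegration.
Local Open Scope ereal_scope.
Context d (T : measurableType d) (R : realType) (mu : {measure set T -> \bar R}).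
Variables (Y G : T -> R).
Hypothesis mY : measurable_fun setT Y.
Hypothesis mG : measurable_fun setT G.
Hypothesis G_ge0 : forall x, (0 <= G x)%R.

Lemma integral_comp_mul_indic (B : set R) : measurable B ->
  \int[mu]_x (\1_B (Y x) * G x)%:E = \int[mu]_(x in Y @^-1` B) (G x)%:E.
Proof.
move=> mB; rewrite [RHS]integral_mkcond; apply: eq_integral => x _.
rewrite patchE indicE; case: ifPn => xB.
  by rewrite mem_set ?mul1r //; move: xB; rewrite inE.
by rewrite memNset ?mul0r //= => h; move: xB; rewrite notin_setE; apply.
Qed.

Import HBNNSimple.

Let integral_comp_mul_nnsfun (f : {nnsfun R >-> R}) :
  \int[mu]_x (f (Y x) * G x)%:E =
  \sum_(k \in range f) (k%:E * \int[mu]_(x in Y @^-1` (f @^-1` [set k])) (G x)%:E).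
Proof.
have mk k : measurable_fun setT (fun x => (k * \1_(f @^-1` [set k]) (Y x) * G x)%R).
  apply: measurable_funM => //; apply: measurable_funM => //.
  exact: measurableT_comp.
transitivity (\sum_(k \in range f) \int[mu]_x (k * \1_(f @^-1` [set k]) (Y x) * G x)%:E).
  rewrite -ge0_integral_fsum//; last 2 first.
  - by move=> k; exact/measurable_EFinP/mk.
  - move=> k x _; rewrite lee_fin mulr_ge0 //.
    by have := nnfun_muleindic_ge0 f k (Y x); rewrite -EFinM lee_fin.
  apply: eq_integral => x _; rewrite fsumEFin //; congr EFin.
  by rewrite -mulr_fsuml -fimfunE.
apply: eq_fsbigr => k /[!inE] -[y _ <-].
rewrite -integral_comp_mul_indic; last exact: measurable_funPTI.
rewrite -ge0_integralZl //=; last first.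
- by rewrite lee_fin.
- by move=> x _; rewrite lee_fin mulr_ge0 // indicE.
- apply/measurable_EFinP; apply: measurable_funM => //.
  exact: measurableT_comp.
by apply: eq_integral => x _; rewrite -EFinM mulrA.
Qed.

(** Through simple functions, the integral of [g(Y) G] depends only on the set function sending [B]
    to the integral of [G] over [Y] in [B]. *)
Lemma integral_comp_mulE (g : R -> R) (mg : measurable_fun setT g) :
  (forall y, (0 <= g y)%R) ->
  let f := nnsfun_approx measurableT (proj2 (measurable_EFinP _ _) mg) in
  \int[mu]_x (g (Y x) * G x)%:E =
  limn (fun n => \sum_(k \in range (f n))
     (k%:E * \int[mu]_(x in Y @^-1` (f n @^-1` [set k])) (G x)%:E)).
Proof.
move=> g0 f.
transitivity (limn (fun n => \int[mu]_x (f n (Y x) * G x)%:E)); last first.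
  by congr (limn _); apply/funext => n; exact: integral_comp_mul_nnsfun.
rewrite -monotone_convergence //.
- apply: eq_integral => x _; apply/esym/cvg_lim => //.
  apply: cvg_EFin; first exact: nearW.
  apply: cvgM; last exact: cvg_cst.
  have := @cvg_nnsfun_approx _ _ R _ measurableT _ (proj2 (measurable_EFinP _ _) mg)
    (fun x _ => g0 x) (Y x) I.
  by move=> /fine_cvgP[].
- move=> n; apply/measurable_EFinP; apply: measurable_funM => //.
  exact: measurableT_comp.
- by move=> n x _; rewrite lee_fin mulr_ge0.
- move=> x _ m n mn; rewrite lee_fin ler_wpM2r //.
  exact/lefP/nd_nnsfun_approx.
Qed.

End Disintegration.

Section EqIntegral.
Import HBNNSimple.

(** Used in two ways: with [G1 = 1] and [G2] a density it transports an expectation to the law of a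
    variable; with [G1] the product of the other factors and [G2] constant it is the induction step
    for independence. *)
Lemma eq_integral_comp_mul (R : realType) d1 (T1 : measurableType d1) d2
    (T2 : measurableType d2) (mu1 : {measure set T1 -> \bar R})
    (mu2 : {measure set T2 -> \bar R}) (Y1 G1 : T1 -> R) (Y2 G2 : T2 -> R) (g : R -> R) :
  measurable_fun setT Y1 -> measurable_fun setT G1 -> (forall x, 0 <= G1 x) ->
  measurable_fun setT Y2 -> measurable_fun setT G2 -> (forall x, 0 <= G2 x) ->
  (forall B, measurable B ->
    (\int[mu1]_(x in Y1 @^-1` B) (G1 x)%:E = \int[mu2]_(x in Y2 @^-1` B) (G2 x)%:E)%E) ->
  measurable_fun setT g -> (forall y, 0 <= g y) ->
  (\int[mu1]_x (g (Y1 x) * G1 x)%:E = \int[mu2]_x (g (Y2 x) * G2 x)%:E)%E.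
Proof.
move=> mY1 mG1 G10 mY2 mG2 G20 H mg g0.
rewrite (integral_comp_mulE _ mY1 mG1 G10 mg g0) (integral_comp_mulE _ mY2 mG2 G20 mg g0).
congr (limn _); apply/funext => n; apply: eq_fsbigr => k _.
by rewrite H //; exact: measurable_funPTI.
Qed.

End EqIntegral.

Section IndependentProducts.
Context d (T : measurableType d) (R : realType) (P : probability T R).
Variables (I : eqType) (F : I -> T -> R).
Hypothesis mF : forall i, measurable_fun setT (F i).
Hypothesis F_indep : mutually_independent P F.

Lemma measurable_prod_seq (s : seq I) (g : I -> R -> R) :
  (forall i, measurable_fun setT (g i)) ->
  measurable_fun setT (fun x => \prod_(i <- s) g i (F i x)).
Proof.
move=> mg; elim: s => [|i s ih].
  by under eq_fun do rewrite big_nil; exact: measurable_cst.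
under eq_fun do rewrite big_cons.
by apply: measurable_funM => //; exact: measurableT_comp.
Qed.

Lemma integral_indic_comp i (B : set R) : measurable B ->
  (\int[P]_x (\1_B (F i x))%:E = P (F i @^-1` B))%E.
Proof.
move=> mB; transitivity (\int[P]_x (\1_(F i @^-1` B) x)%:E)%E.
  by apply: eq_integral => x _.
rewrite integral_indic ?setIT //.
by rewrite -[X in measurable X]setTI; exact: mF.
Qed.

Let indep_indic (s : seq I) (B : I -> set R) : uniq s -> (forall i, measurable (B i)) ->
  (\int[P]_x (\prod_(i <- s) \1_(B i) (F i x))%:E =
   \prod_(i <- s) \int[P]_x (\1_(B i) (F i x))%:E)%E.
Proof.
move=> us mB; have mFB i : measurable (F i @^-1` B i).
  by rewrite -[X in measurable X]setTI; exact: mF.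
under [in RHS]eq_bigr => i _ do rewrite (integral_indic_comp _ (mB i)).
rewrite -F_indep // -[in RHS](setIT (\bigcap_(i in _) _)) -integral_indic //; last first.
  by apply: fin_bigcap_measurable => //; exact: finite_seq.
apply: eq_integral => x _; congr EFin; rewrite indicE.
elim: s {us} => [|i s ih]; first by rewrite big_nil set_nil bigcap_set0 in_setT.
have sE : [set` i :: s] = i |` [set` s].
  apply/seteqP; split=> y /=; rewrite inE; first by move=> /orP[/eqP ->|ys]; [left|right].
  by move=> [->|->]; rewrite ?eqxx ?orbT.
rewrite big_cons ih sE bigcap_setU1 indicE in_setI /=.
by rewrite -[x \in F i @^-1` B i]/(F i x \in B i); case: (_ \in B i); rewrite ?mul1r ?mul0r.
Qed.

(* The functions are introduced one at a time: those of [s2] are still indicators. *)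
Let indep_prod_indic (s1 s2 : seq I) (g : I -> R -> R) (e : I -> R) :
  uniq (s1 ++ s2) -> (forall i, measurable_fun setT (g i)) -> (forall i y, 0 <= g i y) ->
  (forall i, i \in s2 -> exists2 B, measurable B & g i = \1_B) ->
  (forall i, i \in s1 ++ s2 -> \int[P]_x (g i (F i x))%:E = (e i)%:E)%E ->
  (\int[P]_x (\prod_(i <- s1 ++ s2) g i (F i x))%:E = (\prod_(i <- s1 ++ s2) e i)%:E)%E.
Proof.
elim: s1 s2 g e => [|i s1 ih] s2 g e us mg g0 hB he.
  have /choice[B hB'] : forall i, exists B, measurable B /\ (i \in s2 -> g i = \1_B).
    move=> i; have [/hB[B mB gB]|] := boolP (i \in s2); first by exists B.
    by exists set0; split.
  transitivity (\int[P]_x (\prod_(i <- s2) \1_(B i) (F i x))%:E)%E.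
    apply: eq_integral => x _; congr EFin; apply: eq_big_seq => i si.
    by rewrite (proj2 (hB' i)).
  rewrite indep_indic //; last by move=> i; exact: (proj1 (hB' i)).
  rewrite -prodEFin; apply: eq_big_seq => i si.
  by rewrite -(proj2 (hB' i)) // he.
move: (us); rewrite cat_cons cons_uniq => /andP[ni us'].
pose G x := \prod_(j <- s1 ++ s2) g j (F j x).
pose c := \prod_(j <- s1 ++ s2) e j.
have mG : measurable_fun setT G by exact: measurable_prod_seq.
have G0 x : 0 <= G x by apply: prodr_ge0 => j _.
have e0 j : j \in s1 ++ s2 -> 0 <= e j.
  move=> js; rewrite -lee_fin -he ?inE ?js ?orbT //.
  by apply: integral_ge0 => x _; rewrite lee_fin.
have c0 : 0 <= c.
  rewrite /c big_seq; apply: prodr_ge0 => j js; exact: e0.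
(* Integrated form of the independence of [G] and [F i]: the induction hypothesis applied with [g i]
   replaced by the indicator of [B] and [i] moved to the indicator part. *)
have key B : measurable B ->
    (\int[P]_(x in F i @^-1` B) (G x)%:E = \int[P]_(x in F i @^-1` B) c%:E)%E.
  move=> mB; have mFB : measurable (F i @^-1` B).
    by rewrite -[X in measurable X]setTI; exact: mF.
  rewrite -integral_comp_mul_indic // integral_cst //.
  pose g' j : R -> R := if j == i then \1_B else g j.
  pose e' j := if j == i then fine (P (F i @^-1` B)) else e j.
  have g'E j : j \in s1 ++ s2 -> g' j = g j.
    by move=> js; rewrite /g'; case: eqP js => // ->; rewrite (negPf ni).
  have e'E j : j \in s1 ++ s2 -> e' j = e j.
    by move=> js; rewrite /e'; case: eqP js => // ->; rewrite (negPf ni).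
  have pe : perm_eq (i :: s1 ++ s2) (s1 ++ i :: s2).
    by rewrite perm_sym perm_catC /= perm_cons perm_catC.
  have := ih (i :: s2) g' e'.
  rewrite -(perm_uniq pe) => /(_ us).
  have mg' j : measurable_fun setT (g' j) by rewrite /g'; case: ifP.
  have g'0 j y : 0 <= g' j y by rewrite /g'; case: ifP => // _; rewrite indicE.
  have hB' j : j \in i :: s2 -> exists2 B, measurable B & g' j = \1_B.
    rewrite inE /g'; case: eqP => [_ _|_ /= /hB //]; by exists B.
  have he' j : j \in s1 ++ i :: s2 -> (\int[P]_x (g' j (F j x))%:E = (e' j)%:E)%E.
    rewrite -(perm_mem pe) inE /g' /e'; case: eqP => [-> _|_ /= js]; last first.
      by rewrite he // inE js orbT.
    rewrite fineK; last exact: fin_num_measure.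
    exact: integral_indic_comp.
  move=> /(_ mg' g'0 hB' he').
  rewrite -(perm_big _ pe) big_cons /= (eq_big_seq _ e'E) {1}/e' eqxx => ihB.
  transitivity (\int[P]_x (\prod_(j <- s1 ++ i :: s2) g' j (F j x))%:E)%E.
    apply: eq_integral => x _; congr EFin; rewrite -(perm_big _ pe) big_cons /=.
    rewrite {1}/g' eqxx; congr (_ * _); rewrite /G.
    by apply: eq_big_seq => j js; rewrite g'E.
  rewrite ihB EFinM fineK; last exact: fin_num_measure.
  exact: muleC.
transitivity (\int[P]_x (g i (F i x) * G x)%:E)%E.
  by apply: eq_integral => x _; rewrite big_cons.
rewrite (eq_integral_comp_mul (mF i) mG G0 (mF i) (measurable_cst c) (fun=> c0) key
  (mg i) (g0 i)).
transitivity (\int[P]_x (c%:E * (g i (F i x))%:E))%E.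
  by apply: eq_integral => x _; rewrite mulrC EFinM.
rewrite ge0_integralZl //=; last 2 first.
- by apply/measurable_EFinP; exact: measurableT_comp.
- by move=> x _; rewrite lee_fin.
by rewrite he ?inE ?eqxx // big_cons -EFinM mulrC.
Qed.

Lemma independent_prod (s : seq I) (g : I -> R -> R) (e : I -> R) :
  uniq s -> (forall i, measurable_fun setT (g i)) -> (forall i y, 0 <= g i y) ->
  (forall i, i \in s -> \int[P]_x (g i (F i x))%:E = (e i)%:E)%E ->
  (\int[P]_x (\prod_(i <- s) g i (F i x))%:E = (\prod_(i <- s) e i)%:E)%E.
Proof.
move=> us mg g0 he; have := @indep_prod_indic s [::] g e.
by rewrite cats0; apply.
Qed.

End IndependentProducts.

Section Deviation.
Context d (T : measurableType d) (R : realType) (P : probability T R).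
Variables (I : eqType) (F : I -> T -> R).
Hypothesis mF : forall i, measurable_fun setT (F i).
Hypothesis F_indep : mutually_independent P F.
Variable i_ : nat -> I.
Hypothesis i_inj : injective i_.

(** Markov's inequality for the product of independent exponentials; [s] may have either sign, so
    both tails are instances. *)
Lemma chernoff (s m r : R) (n : nat) :
  (forall k, \int[P]_x (expR (s * (F (i_ k) x - m)))%:E <= r%:E)%E ->
  (P [set x | 0 <= s * ((\sum_(k < n) F (i_ k) x) - n%:R * m)]%R <= (r ^+ n)%:E)%E.
Proof.
move=> hr.
pose g (_ : I) (y : R) := expR (s * (y - m)).
have mg i : measurable_fun setT (g i).
  apply: measurableT_comp => //; apply: measurable_funM => //.
  exact: measurable_funB.
have mgF i : measurable_fun setT (fun x => g i (F i x)) by exact: measurableT_comp.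
pose e i := fine (\int[P]_x (g i (F i x))%:E).
have int0 i : (0 <= \int[P]_x (g i (F i x))%:E)%E.
  by apply: integral_ge0 => x _; rewrite lee_fin expR_ge0.
pose S := [seq i_ k | k <- index_iota 0 n].
have uS : uniq S by rewrite map_inj_uniq ?iota_uniq.
have heS i : i \in S -> (\int[P]_x (g i (F i x))%:E = (e i)%:E)%E.
  move=> /mapP[k _ ->]; rewrite fineK // ge0_fin_numE //.
  exact: le_lt_trans (hr k) (ltry _).
have g0 i y : 0 <= g i y by exact: expR_ge0.
have prodE := independent_prod mF F_indep uS mg g0 heS.
have sumE x : \prod_(i <- S) g i (F i x) =
    expR (s * ((\sum_(k < n) F (i_ k) x) - n%:R * m)).
  rewrite big_map big_mkord -expR_sum; congr expR.
  by rewrite -mulr_sumr sumrB sumr_const card_ord mulr_natl.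
set A := [set x | _].
have mA : measurable A.
  have := @measurable_fun_le _ _ _ setT (cst 0)
    (fun x => s * ((\sum_(k < n) F (i_ k) x) - n%:R * m)).
  rewrite setTI; apply => //; apply: measurable_funM => //.
  apply: measurable_funB => //; apply: measurable_sum => k; exact: mF.
rewrite -[A]setIT -integral_indic //.
apply: (@le_trans _ _ (\int[P]_x (\prod_(i <- S) g i (F i x))%:E)%E).
  apply: ge0_le_integral => //.
  - by apply/measurable_EFinP; exact: measurable_indic.
  - by apply/measurable_EFinP; exact: measurable_prod_seq.
  move=> x _; rewrite lee_fin sumE indicE; case: (boolP (x \in A)) => xA; last exact: expR_ge0.
  rewrite -[leLHS]/(1 : R) -[leLHS]expR0 ler_expR; exact: set_mem xA.
rewrite prodE lee_fin big_map big_mkord.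
rewrite -[n in leRHS]card_ord -prodr_const; apply: ler_prod => k _.
rewrite /e; apply/andP; split; first exact: fine_ge0.
rewrite -lee_fin fineK; first exact: hr.
by rewrite ge0_fin_numE //; exact: le_lt_trans (hr k) (ltry _).
Qed.

Definition deviates (m xi : R) (n : nat) : set T :=
  [set x | xi <= `|m - (\sum_(k < n) F (i_ k) x) / n%:R|].

Lemma measurable_deviates m xi n : measurable (deviates m xi n).
Proof.
have := @measurable_fun_le _ _ _ setT (cst xi)
  (fun x => `|m - (\sum_(k < n) F (i_ k) x) / n%:R|).
rewrite setTI; apply => //; apply: measurableT_comp => //.
apply: measurable_funB => //; apply: measurable_funM => //.
apply: measurable_sum => k; exact: mF.
Qed.

Lemma deviates_le (m xi s r s' r' : R) (n : nat) : 0 < s -> 0 < s' ->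
  (forall k, \int[P]_x (expR (s * (F (i_ k) x - (m + xi))))%:E <= r%:E)%E ->
  (forall k, \int[P]_x (expR (- s' * (F (i_ k) x - (m - xi))))%:E <= r'%:E)%E ->
  (P (deviates m xi n.+1) <= (r ^+ n.+1 + r' ^+ n.+1)%:E)%E.
Proof.
move=> s0 s'0 h1 h2.
have c1 := chernoff n.+1 h1; have c2 := chernoff n.+1 h2.
set A1 := [set x | _] in c1; set A2 := [set x | _] in c2.
have mle (f : T -> R) : measurable_fun setT f -> measurable [set x | 0 <= f x].
  by move=> mf; have := @measurable_fun_le _ _ _ setT (cst 0) f; rewrite setTI; apply.
have msum : measurable_fun setT (fun x => \sum_(k < n.+1) F (i_ k) x).
  apply: measurable_sum => k; exact: mF.
have mA1 : measurable A1.
  by apply: mle; apply: measurable_funM => //; exact: measurable_funB.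
have mA2 : measurable A2.
  by apply: mle; apply: measurable_funM => //; exact: measurable_funB.
apply: (@le_trans _ _ (P (A1 `|` A2))).
  apply: le_measure; rewrite ?inE; [exact: measurable_deviates|exact: measurableU|].
  move=> x; rewrite /deviates /A1 /A2 /=; set S := \sum_(_ < _) _.
  have n0 : 0 < n.+1%:R :> R by [].
  rewrite ler_normr => /orP[h|h]; [right|left].
    rewrite mulNr -mulrN mulr_ge0 ?(ltW s'0) // oppr_ge0 subr_le0.
    by rewrite mulrC -ler_pdivrMr // lerBrDr -lerBrDl.
  rewrite mulr_ge0 ?(ltW s0) // subr_ge0 mulrC -ler_pdivlMr //.
  by move: h; rewrite opprB lerBrDl.
apply: (le_trans (measureU2 _ mA1 mA2)).
by rewrite EFinD leeD.
Qed.

End Deviation.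

Lemma measurable_preimage (R : realType) d (T : measurableType d) (Z : T -> R) (B : set R) :
  measurable_fun setT Z -> measurable B -> measurable (Z @^-1` B).
Proof. by move=> mZ mB; rewrite -[X in measurable X]setTI; exact: mZ. Qed.

(** * Exponential moments of rewards and costs *)

Section RewardTails.
Variables (R : realType) (rho : {measure set (measurableTypeR R) -> \bar R}).
Variable h : R -> R.
Hypothesis h_ge0 : forall x, 0 <= h x.
Hypothesis h_meas : measurable_fun setT h.
Local Notation Theta := (ef_Theta rho h).
Local Notation b := (ef_b rho h).
Local Notation M := (ef_M rho h).
Local Notation th := (ef_theta rho h).
Hypothesis M_nondeg : exists x y, [/\ M x, M y & x != y].
Context d (T : measurableType d) (P : probability T R).

(** Exponential tilting by [s] moves the parameter from [t] to [t + s] inside the family, so the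
    moment is a ratio of masses. *)
Lemma ef_mgf (t s k : R) (Z : T -> R) : Theta (t + s) -> measurable_fun setT Z ->
  (forall A, measurable A -> P (Z @^-1` A) = ef_nu rho h t A) ->
  (\int[P]_x (expR (s * (Z x - k)))%:E = (expR (b (t + s) - b t - s * k))%:E)%E.
Proof.
move=> tsT mZ lawZ.
pose g (y : R) := expR (s * (y - k)).
have mg : measurable_fun setT g.
  apply: measurableT_comp => //; apply: measurable_funM => //.
  exact: measurable_funB.
have mdens : measurable_fun setT (ef_dens rho h t).
  apply: measurable_funM => //; apply: measurableT_comp => //.
  exact: measurable_funB.
have dens0 x : 0 <= ef_dens rho h t x by rewrite mulr_ge0 ?expR_ge0.
transitivity (\int[P]_x (g (Z x) * cst 1 x)%:E)%E.
  by apply: eq_integral => x _; rewrite /= mulr1.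
have g0 y : 0 <= g y by exact: expR_ge0.
have m1 : measurable_fun setT (cst 1 : T -> R) by exact: measurable_cst.
have pos1 w : 0 <= (cst 1 : T -> R) w by exact: ler01.
have mid : measurable_fun setT (idfun : R -> R) by exact: measurable_id.
have key B : measurable B -> (\int[P]_(x in Z @^-1` B) (cst 1 x)%:E =
    \int[rho]_(x in idfun @^-1` B) (ef_dens rho h t x)%:E)%E.
  move=> mB; rewrite [LHS](_ : _ = P (Z @^-1` B)); last first.
    exact: etrans (integral_cst P (measurable_preimage mZ mB) 1%:E) (mul1e _).
  by rewrite lawZ.
rewrite (@eq_integral_comp_mul R _ _ _ _ P rho Z (cst 1) idfun (ef_dens rho h t) g
  mZ m1 pos1 mid mdens dens0 key mg g0).
have It := ef_mass_gt0 h_ge0 h_meas M_nondeg tsT.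
transitivity (\int[rho]_x ((expR (- b t - s * k))%:E * (ef_unnorm h (t + s) x)%:E))%E.
    apply: eq_integral => x _; rewrite -EFinM /g /ef_dens /ef_unnorm; congr EFin.
    rewrite mulrCA [RHS]mulrCA; congr (_ * _); rewrite -!expRD; congr expR => /=.
    by move: (b t) => bt; clear; ring.
  have mu : measurable_fun setT (fun x => (ef_unnorm h (t + s) x)%:E).
    by apply/measurable_EFinP; exact: measurable_ef_unnorm.
  have u0 x : setT x -> (0 <= (ef_unnorm h (t + s) x)%:E)%E.
    by move=> _; rewrite lee_fin ef_unnorm_ge0.
  rewrite (ge0_integralZl rho measurableT mu u0); last by rewrite lee_fin expR_ge0.
  have -> : (\int[rho]_x (ef_unnorm h (t + s) x)%:E)%E = (ef_mass rho h (t + s))%:E.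
    by rewrite /ef_mass /Rintegral fineK //; exact: integrable_fin_num.
  rewrite -EFinM; congr EFin; rewrite -[X in _ * X]lnK ?posrE // -expRD; congr expR.
  rewrite -/(b (t + s)); move: (b t) (b (t + s)) => bt bts; clear; ring.
Qed.

Lemma reward_tails x xi : M x -> 0 < xi ->
  exists s r, [/\ 0 < s, 0 <= r < 1 & forall Z : T -> R, measurable_fun setT Z ->
    (forall A, measurable A -> P (Z @^-1` A) = ef_nu rho h (th x) A) ->
    (\int[P]_w (expR (s * (Z w - (x + xi))))%:E <= r%:E)%E /\
    (\int[P]_w (expR (- s * (Z w - (x - xi))))%:E <= r%:E)%E ].
Proof.
move=> Mx xi0.
have [s [s0 Tp bp Tm bm]] := ef_chernoff h_ge0 h_meas M_nondeg Mx xi0.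
pose r1 := expR (b (th x + s) - b (th x) - s * (x + xi)).
pose r2 := expR (b (th x + - s) - b (th x) - - s * (x - xi)).
exists s, (Num.max r1 r2); split => //.
  have r1_ge0 : 0 <= r1 := expR_ge0 _.
  have r1_lt1 : r1 < 1 by rewrite expR_lt1 subr_lt0.
  have r2_lt1 : r2 < 1 by rewrite expR_lt1 subr_lt0.
  by rewrite le_max r1_ge0 gt_max r1_lt1 r2_lt1.
move=> Z mZ lawZ; split.
  by rewrite (ef_mgf _ Tp mZ lawZ) lee_fin le_max lexx.
by rewrite (ef_mgf _ Tm mZ lawZ) lee_fin le_max lexx orbT.
Qed.

End RewardTails.

(** From [exp(-v) >= 1 - v], and [(1 + v + 2 v ^ 2) (1 - v) - 1 = v ^ 2 (1 - 2 v) >= 0]. *)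
Lemma expR_le_quad (R : realType) (v : R) : v <= 1 / 2 -> expR v <= 1 + v + 2 * v ^+ 2.
Proof.
move=> v2; have v1 : 0 < 1 - v by lra.
have h1 : 1 - v <= expR (- v) by exact: expR_ge1Dx.
have h2 : expR v * (1 - v) <= 1.
  by rewrite -[leRHS](expRxMexpNx_1 v) ler_wpM2l // expR_ge0.
have h3 : 1 <= (1 + v + 2 * v ^+ 2) * (1 - v).
  have : 0 <= v ^+ 2 * (1 - 2 * v) by rewrite mulr_ge0 ?sqr_ge0 //; lra.
  have -> : (1 + v + 2 * v ^+ 2) * (1 - v) = 1 + v ^+ 2 * (1 - 2 * v) by ring.
  lra.
by rewrite -(ler_pM2r v1); exact: le_trans h3.
Qed.

Lemma dist_le1 (R : realType) (ell x y : R) : 0 < ell -> ell <= x <= 1 -> ell <= y <= 1 ->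
  `|x - y| <= 1.
Proof.
by move=> l0 /andP[? ?] /andP[? ?]; rewrite ler_norml; apply/andP; split; lra.
Qed.

Section CostTails.
Variables (R : realType) (kap : probability (measurableTypeR R) R) (ell : R).
Hypothesis ell_gt0 : 0 < ell.
Hypothesis kap_supp : kap `[ell, 1]%classic = 1%E.
Let c := Rintegral kap setT (fun x => x).

(** An everywhere bounded version of the identity, equal to it almost surely, so that integrability
    is immediate. *)
Let clamp (x : R) : R := Num.min (Num.max x ell) 1.

Lemma cost_ell_le1 : ell <= 1.
Proof.
rewrite leNgt; apply/negP => l1.
by move: kap_supp; rewrite set_itv_ge ?bnd_simp -?ltNge // measure0 => /esym/eqP; rewrite onee_eq0.
Qed.

Let clamp_itv x : ell <= clamp x <= 1.
Proof.
by rewrite /clamp le_min cost_ell_le1 le_max lexx orbT ge_min lexx orbT.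
Qed.

Let mclamp : measurable_fun setT clamp.
Proof.
apply: measurable_minr => //; exact: measurable_maxr.
Qed.

Let clamp_ae : {ae kap, forall x, clamp x = x}.
Proof.
exists (~` `[ell, 1]%classic); split.
- exact: measurableC.
- by rewrite probability_setC // kap_supp subee.
move=> x /= nx; apply: contra_not nx; rewrite in_itv/= => /andP[lx x1].
by rewrite /clamp (max_idPl lx) (min_idPl x1).
Qed.

Let int_bounded (f : R -> R) (D : R) : measurable_fun setT f -> (forall x, `|f x| <= D) ->
  kap.-integrable setT (EFin \o f).
Proof.
move=> mf fD; apply: measurable_bounded_integrable => //.
  by apply: le_lt_trans (probability_le1 kap measurableT) (ltry _).
exists D; split; first exact: num_real.
by move=> x Dx y _; apply: (le_trans (fD y)); exact: ltW.
Qed.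

Let clamp_int : kap.-integrable setT (EFin \o clamp).
Proof.
apply: (@int_bounded _ 1) => // x; have /andP[h1 h2] := clamp_itv x.
by rewrite ger0_norm // (le_trans (ltW ell_gt0)).
Qed.

Let cint (k : R) : kap.-integrable setT (EFin \o (fun=> k)).
Proof. by apply: (@int_bounded _ `|k|). Qed.

Let cstE (k : R) : Rintegral kap setT (fun=> k) = k.
Proof.
have k1 : fine (kap setT) = 1 := congr1 fine (probability_setT kap).
by rewrite Rintegral_cst // k1 mulr1.
Qed.

Lemma cost_meanE : c = Rintegral kap setT clamp.
Proof.
congr fine; apply: ae_eq_integral => //; try exact/measurable_EFinP.
by apply: aeS clamp_ae => x ex _; congr EFin.
Qed.

Lemma cost_mean_itv : ell <= c <= 1.
Proof.
rewrite cost_meanE.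
rewrite -[X in X <= _ <= _]cstE -[X in _ <= _ <= X]cstE.
by apply/andP; split; apply: le_Rintegral => // x _; have /andP[] := clamp_itv x.
Qed.

Context d (T : measurableType d) (P : probability T R).

Let cost_mgf (s : R) (Z : T -> R) : `|s| <= 1 / 2 -> measurable_fun setT Z ->
  (forall A, measurable A -> P (Z @^-1` A) = kap A) ->
  (\int[P]_w (expR (s * (Z w - c)))%:E <= (1 + 2 * s ^+ 2)%:E)%E.
Proof.
move=> s2 mZ lawZ.
pose g (y : R) := expR (s * (y - c)).
have mg : measurable_fun setT g.
  apply: measurableT_comp => //; apply: measurable_funM => //.
  exact: measurable_funB.
have -> : (\int[P]_w (expR (s * (Z w - c)))%:E = \int[P]_x (g (Z x) * cst 1 x)%:E)%E.
  by apply: eq_integral => x _; rewrite /= mulr1.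
have g0 y : 0 <= g y by exact: expR_ge0.
have key B : measurable B -> (\int[P]_(x in Z @^-1` B) (cst 1 x)%:E =
    \int[kap]_(x in idfun @^-1` B) (cst 1 x)%:E)%E.
  move=> mB; rewrite [LHS](_ : _ = P (Z @^-1` B)); last first.
    exact: etrans (integral_cst P (measurable_preimage mZ mB) 1%:E) (mul1e _).
  rewrite lawZ //; apply/esym; exact: etrans (integral_cst kap mB 1%:E) (mul1e _).
have m1 : measurable_fun setT (cst 1 : T -> R) by exact: measurable_cst.
have m1' : measurable_fun setT (cst 1 : R -> R) by exact: measurable_cst.
have mid : measurable_fun setT (idfun : R -> R) by exact: measurable_id.
have pos1 w : 0 <= (cst 1 : T -> R) w by exact: ler01.
have pos1' w : 0 <= (cst 1 : R -> R) w by exact: ler01.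
rewrite (@eq_integral_comp_mul R _ _ _ _ P kap Z (cst 1) idfun (cst 1) g
  mZ m1 pos1 mid m1' pos1' key mg g0).
pose f x := 1 + s * (clamp x - c) + 2 * s ^+ 2.
have dint : kap.-integrable setT (EFin \o (fun x => clamp x - c)).
  exact: (integrableB measurableT clamp_int (cint c)).
have sint : kap.-integrable setT (EFin \o (fun x => s * (clamp x - c))).
  exact: (integrableZl measurableT s dint).
have s1int : kap.-integrable setT (EFin \o (fun x => 1 + s * (clamp x - c))).
  exact: (integrableD measurableT (cint 1) sint).
have fint : kap.-integrable setT (EFin \o f).
  exact: (integrableD measurableT s1int (cint (2 * s ^+ 2))).
have fE x : expR (s * (clamp x - c)) <= f x.
  have cc : `|clamp x - c| <= 1.
    by apply: (dist_le1 ell_gt0 (clamp_itv x)); exact: cost_mean_itv.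
  have sc : `|s * (clamp x - c)| <= `|s| by rewrite normrM ler_piMr.
  have sc1 : s * (clamp x - c) <= 1 / 2.
    by apply: (le_trans (ler_norm _)); exact: le_trans s2.
  apply: (le_trans (expR_le_quad sc1)); rewrite /f lerD2l ler_pM2l //.
  rewrite -[X in X ^+ 2]/(s * (clamp x - c)) -[leLHS]real_normK ?num_real //.
  by rewrite -[leRHS]real_normK ?num_real // ler_sqr ?nnegrE.
apply: (@le_trans _ _ (\int[kap]_x (f x)%:E)%E).
  apply: ae_ge0_le_integral => //.
  - by move=> x _; rewrite lee_fin mulr_ge0 ?ler01 ?g0.
  - apply/measurable_EFinP; apply: measurable_funM => //.
  - by move=> x _; rewrite lee_fin (le_trans _ (fE x)) // expR_ge0.
  - exact: measurable_int fint.
  - apply: aeS clamp_ae => x ex _; rewrite lee_fin /= mulr1 /g.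
    by have := fE x; rewrite ex.
have -> : (\int[kap]_x (f x)%:E = (Rintegral kap setT f)%:E)%E.
  by rewrite /Rintegral fineK //; exact: integrable_fin_num.
rewrite /f (RintegralD measurableT s1int (cint _)) (RintegralD measurableT (cint _) sint).
rewrite (RintegralZl s measurableT dint) (RintegralB measurableT clamp_int (cint c)).
by rewrite !cstE -cost_meanE subrr mulr0 addr0.
Qed.

Lemma cost_tails (xi : R) : 0 < xi ->
  exists s r, [/\ 0 < s, 0 <= r < 1 & forall Z : T -> R, measurable_fun setT Z ->
    (forall A, measurable A -> P (Z @^-1` A) = kap A) ->
    (\int[P]_w (expR (s * (Z w - (c + xi))))%:E <= r%:E)%E /\
    (\int[P]_w (expR (- s * (Z w - (c - xi))))%:E <= r%:E)%E ].
Proof.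
(* The choice gives [s <= 1 / 2], as [cost_mgf] requires, and [2 s < xi], so that
   [1 + 2 s ^ 2 < 1 + s xi <= exp(s xi)]. *)
move=> xi0; pose s := Num.min xi 1 / 4.
have m0 : 0 < Num.min xi 1 by rewrite lt_min xi0 ltr01.
have m1 : Num.min xi 1 <= 1 by rewrite ge_min lexx orbT.
have mx : Num.min xi 1 <= xi by rewrite ge_min lexx.
have s0 : 0 < s by rewrite /s; lra.
have s1 : s <= 1 / 2 by rewrite /s; lra.
have sx : 2 * s < xi by rewrite /s; lra.
exists s, ((1 + 2 * s ^+ 2) * expR (- (s * xi))); split => //.
  have q0 : 0 <= 1 + 2 * s ^+ 2 by have := sqr_ge0 s; lra.
  rewrite mulr_ge0 ?expR_ge0 //= expRN ltr_pdivrMr ?expR_gt0 // mul1r.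
  apply: (@lt_le_trans _ _ (1 + s * xi)); last exact: expR_ge1Dx.
  by rewrite ltrD2l expr2 mulrA [ltLHS]mulrC ltr_pM2l.
have scale (t k : R) (Z : T -> R) : t ^+ 2 = s ^+ 2 -> `|t| <= 1 / 2 -> t * k = s * xi ->
    measurable_fun setT Z -> (forall A, measurable A -> P (Z @^-1` A) = kap A) ->
    (\int[P]_w (expR (t * (Z w - (c + k))))%:E <=
      ((1 + 2 * s ^+ 2) * expR (- (s * xi)))%:E)%E.
  move=> ts t2 tk mZ lawZ.
  have mg : measurable_fun setT (fun w => (expR (t * (Z w - c)))%:E).
    apply/measurable_EFinP; apply: measurableT_comp => //; apply: measurable_funM => //.
    exact: measurable_funB.
  have -> : (\int[P]_w (expR (t * (Z w - (c + k))))%:E =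
      \int[P]_w ((expR (- (s * xi)))%:E * (expR (t * (Z w - c)))%:E))%E.
    apply: eq_integral => w _; rewrite -EFinM -expRD; congr (expR _)%:E.
    by rewrite -tk; ring.
  have g0 w : setT w -> (0 <= (expR (t * (Z w - c)))%:E)%E.
    by move=> _; rewrite lee_fin expR_ge0.
  rewrite (ge0_integralZl P measurableT mg g0); last by rewrite lee_fin expR_ge0.
  rewrite EFinM muleC lee_pmul2r //; last by rewrite lte_fin expR_gt0.
  by rewrite -ts; exact: cost_mgf.
move=> Z mZ lawZ; split.
  by apply: scale => //; rewrite gtr0_norm.
rewrite -[c - xi]/(c + - xi); apply: scale => //.
- by rewrite sqrrN.
- by rewrite normrN gtr0_norm.
- by rewrite mulrNN.
Qed.

End CostTails.

(** * Expected cost *)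

(** Half of the decay absorbs the square: with [r = q ^ 2] one has
    [r ^ (n + 1) = q ^ (n + 2) q ^ n], and [y ^ 2 / 2 <= exp y] at [y = k (n + 2)] bounds the first
    factor times the square. *)
Lemma sqr_geometric_bound (R : realType) (r : R) : 0 <= r < 1 ->
  exists D q, [/\ 0 <= D, 0 <= q < 1 &
    forall n : nat, (n.+2 ^ 2)%:R * r ^+ n.+1 <= D * q ^+ n].
Proof.
move=> /andP[r0 r1].
have [r00|rn0] := eqVneq r 0.
  exists 0, 0; split; rewrite ?lexx ?ltr01 // => n.
  by rewrite r00 expr0n mulr0 mul0r.
have rp : 0 < r by rewrite lt_neqAle eq_sym rn0.
pose k := - ln r / 2.
have k0 : 0 < k by rewrite divr_gt0 // oppr_gt0 ln_lt0 // rp.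
pose q := expR (- k).
have qp : 0 < q by exact: expR_gt0.
have q1 : q < 1 by rewrite expR_lt1 oppr_lt0.
have rq : r = q ^+ 2.
  by rewrite expr2 -expRD /k -[LHS](lnK rp); congr expR; lra.
exists (2 / k ^+ 2), q; split; rewrite ?(ltW qp) ?q1 ?divr_ge0 ?sqr_ge0 // => n.
have -> : (n.+2 ^ 2)%:R * r ^+ n.+1 = (n.+2 ^ 2)%:R * q ^+ n.+2 * q ^+ n.
  rewrite rq -exprM -mulrA -exprD; congr (_ * _ ^+ _).
  by rewrite mul2n -addnn !addSn !addnS.
rewrite ler_pM2r ?exprn_gt0 //.
have kn : 0 <= k * n.+2%:R by rewrite mulr_ge0 // ltW.
have := expR_ge1Dxn 1 kn; rewrite exprMn => h.
have eq_ : q ^+ n.+2 = (expR (k * n.+2%:R))^-1.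
  by rewrite /q -expRM_natl mulrN expRN mulrC.
rewrite eq_ ler_pdivrMr ?expR_gt0 // -ler_pdivrMl ?divr_gt0 ?exprn_gt0 // invf_div.
rewrite natrX; apply: le_trans h.
have -> : k ^+ 2 / 2 * n.+2%:R ^+ 2 = k ^+ 2 * n.+2%:R ^+ 2 / 2`!%:R by rewrite mulrAC.
by rewrite lerDr.
Qed.

Lemma nneseries_geometric_le (R : realType) (D q : R) (u : (\bar R)^nat) : 0 <= D ->
  0 <= q < 1 -> (forall n, (0 <= u n)%E) -> (forall n, (u n <= (D * q ^+ n)%:E)%E) ->
  (\sum_(n <oo) u n <= (D / (1 - q))%:E)%E.
Proof.
move=> D0 /andP[q0 q1] u0 uq.
have q10 : 0 < 1 - q by rewrite subr_gt0.
apply: lime_le; first by apply: is_cvg_nneseries => n _ _.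
apply: nearW => n; apply: (@le_trans _ _ (\sum_(0 <= k < n) (D * q ^+ k)%:E)%E).
  by apply: lee_sum => k _.
rewrite sumEFin lee_fin -mulr_sumr ler_wpM2l // -[leRHS]mul1r ler_pdivlMr //.
rewrite big_mkord mulrC.
have := subrX1 q n; have := exprn_ge0 n q0.
move: (\sum_(i < n) q ^+ i) (q ^+ n) => S Q Q0 e.
have -> : (1 - q) * S = - ((q - 1) * S) by ring.
by rewrite -e; lra.
Qed.

Section TailTime.
Context d (T : measurableType d) (R : realType) (P : probability T R).
Variable A : nat -> set T.
Hypothesis mA : forall n, measurable (A n).

(* Dominates [n.+2 ^ 2] at every index [n.+1] at which the event [A] occurs, hence the square of the time after which it no longer occurs. *)
Definition tail_weight (x : T) : \bar R :=
  (\sum_(n <oo) ((n.+2 ^ 2)%:R * \1_(A n.+1) x)%:E)%E.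

Let term_ge0 n x : (0 <= ((n.+2 ^ 2)%:R * \1_(A n.+1) x)%:E :> \bar R)%E.
Proof. by rewrite lee_fin mulr_ge0 // indicE. Qed.

Let mterm n : measurable_fun setT (fun x => ((n.+2 ^ 2)%:R * \1_(A n.+1) x)%:E : \bar R).
Proof. by apply/measurable_EFinP; apply: measurable_funM. Qed.

Lemma tail_weight_ge0 x : (0 <= tail_weight x)%E.
Proof. by apply: nneseries_ge0 => n _ _; exact: term_ge0. Qed.

Lemma tail_weight_ge n x : A n.+1 x -> (((n.+2 ^ 2)%:R)%:E <= tail_weight x)%E.
Proof.
move=> Ax; apply: le_trans (nneseries_lim_ge n.+1 (fun k _ _ => term_ge0 k x)).
rewrite big_nat_recr //= indicE mem_set // mulr1 leeDr //.
by apply: sume_ge0 => k _; exact: term_ge0.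
Qed.

Lemma measurable_tail_weight : measurable_fun setT tail_weight.
Proof.
have := @ge0_emeasurable_sum _ _ _ setT
  (fun n x => ((n.+2 ^ 2)%:R * \1_(A n.+1) x)%:E : \bar R) xpredT
  (fun k x _ _ => term_ge0 k x) (fun k _ => mterm k).
exact.
Qed.

Lemma integral_tail_weight (C r : R) : 0 <= C -> 0 <= r < 1 ->
  (forall n, (P (A n.+1) <= (C * r ^+ n.+1)%:E)%E) ->
  exists2 m, 0 <= m & (\int[P]_x tail_weight x <= m%:E)%E.
Proof.
move=> C0 r01 hA; have [D [q [D0 q01 hD]]] := sqr_geometric_bound r01.
have q10 : 0 < 1 - q by rewrite subr_gt0; case/andP: q01.
exists (C * D / (1 - q)); first by rewrite divr_ge0 ?mulr_ge0 // ltW.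
rewrite (integral_nneseries P measurableT mterm (fun n x _ => term_ge0 n x)).
apply: nneseries_geometric_le => //; first exact: mulr_ge0.
  by move=> n; apply: integral_ge0 => x _; exact: term_ge0.
move=> n; under eq_integral do rewrite EFinM.
have mI : measurable_fun setT (fun x => (\1_(A n.+1) x)%:E : \bar R).
  exact/measurable_EFinP.
have I0 x : setT x -> (0 <= (\1_(A n.+1) x)%:E :> \bar R)%E.
  by move=> _; rewrite lee_fin indicE.
rewrite (ge0_integralZl P measurableT mI I0) //.
rewrite integral_indic // setIT.
apply: (@le_trans _ _ ((n.+2 ^ 2)%:R%:E * (C * r ^+ n.+1)%:E)%E).
  by apply: lee_wpmul2l; [rewrite lee_fin|exact: hA].
by rewrite -EFinM lee_fin mulrCA -mulrA ler_wpM2l.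
Qed.

End TailTime.

(** A finite [y] leaves finitely many bad indices, and [n0] is one more than the last; if that one
    is [n + 1], then [n0 ^ 2] is the weight [(n + 2) ^ 2]. *)
Lemma tail_time (T : Type) (R : realType) (A : nat -> T -> Prop) (x : T) (y : R) :
  0 <= y -> (forall n, A n.+1 x -> (n.+2 ^ 2)%:R <= y) ->
  exists n0, [/\ (0 < n0)%N, (n0 ^ 2)%:R <= 1 + y & forall n, (n0 <= n)%N -> ~ A n x].
Proof.
move=> y0 hA.
have bnd n : A n.+1 x -> (n <= Num.bound y)%N.
  move=> /hA ny; rewrite -(ler_nat R); apply: (@le_trans _ _ (n.+2 ^ 2)%:R).
    by rewrite ler_nat (leq_trans _ (leq_pexp2l _ (_ : 1 <= 2)%N)) // expn1 leqW // leqW.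
  by apply: (le_trans ny); apply: ltW; exact: archi_boundP.
have [ex|nex] := pselect (exists n, A n.+1 x).
  pose p n := `[< A n.+1 x >].
  have exp : exists n, p n by case: ex => n An; exists n; exact/asboolP.
  have ubp n : p n -> (n <= Num.bound y)%N by move=> /asboolP; exact: bnd.
  have [n /asboolP An nmax] := ex_maxnP exp ubp.
  exists n.+2; split => //; first by have := hA n An; lra.
  move=> [|k] //; rewrite ltnS => nk Ak.
  by have := nmax k (asboolT Ak); rewrite leqNgt nk.
exists 1%N; split => //; first by rewrite exp1n lerDl.
by move=> [|k] // _ Ak; apply: nex; exists k.
Qed.

Section ExpectedCost.
Variables (R : realType) (K : nat).
Hypothesis K_ge2 : (2 <= K)%N.
Variables (rho : {measure set (measurableTypeR R) -> \bar R}) (h : R -> R).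
Hypothesis h_ge0 : forall x, 0 <= h x.
Hypothesis h_meas : measurable_fun setT h.
Local Notation M := (ef_M rho h).
Local Notation d := (ef_d rho h).
Local Notation th := (ef_theta rho h).
Variables (mu : 'I_K -> R) (a0 : 'I_K).
Hypothesis mu_fam : forall a, M (mu a).
Hypothesis mu_a0 : is_best mu a0.
Variables (kappa : 'I_K -> probability (measurableTypeR R) R) (ell : R).
Hypothesis ell_gt0 : 0 < ell.
Hypothesis kappa_supp : forall a, kappa a `[ell, 1]%classic = 1%E.
Context (dO : measure_display) (Omega : measurableType dO) (P : probability Omega R).
Variables X C : 'I_K -> nat -> Omega -> R.
Hypothesis X_meas : forall a n, measurable_fun setT (X a n).
Hypothesis C_meas : forall a n, measurable_fun setT (C a n).
Hypothesis X_law : forall a n A, measurable A ->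
  P (X a n @^-1` A) = ef_nu rho h (th (mu a)) A.
Hypothesis C_law : forall a n A, measurable A -> P (C a n @^-1` A) = kappa a A.
Let sample (i : 'I_K * nat * bool) : Omega -> R :=
  if i.2 then X i.1.1 i.1.2 else C i.1.1 i.1.2.
Hypothesis XC_indep : mutually_independent P sample.
Variable wstar : ('I_K -> R) -> ('I_K -> R) -> ('I_K -> R).
Hypothesis wstar_max : forall m c', (exists a, is_best m a) -> (forall a, 0 < c' a) ->
  is_maximizer M d m c' (wstar m c').
Variable sel : hist_t R K -> {set 'I_K} -> 'I_K.
Hypothesis sel_in : forall hs (S : {set 'I_K}), (0 < #|S|)%N -> sel hs S \in S.
Variables alpha B : R.
Hypothesis alpha_gt0 : 0 < alpha.
Hypothesis B_gt0 : 0 < B.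
Let Jtau delta om := J_tau d wstar sel X C B alpha delta om.
Hypothesis Jtau_meas : forall delta, measurable_fun [set: Omega] (Jtau delta).
Let c := cost_mean kappa.
Local Notation V := (ctas_obj M d mu c (wstar mu c)).

Lemma M_nondegenerate : exists x y, [/\ M x, M y & x != y].
Proof.
have [b hb] := exists_neq K_ge2 a0.
by exists (mu a0), (mu b); split => //; rewrite gt_eqF //; exact: mu_a0.
Qed.

Lemma cost_mean_ge a : ell <= c a.
Proof. by have /andP[] := cost_mean_itv ell_gt0 (kappa_supp a). Qed.

Let center (j : 'I_K * bool) : R := if j.2 then mu j.1 else c j.1.
Let bad (xi : R) (j : 'I_K * bool) : nat -> set Omega :=
  deviates sample (fun k => ((j.1, k), j.2)) (center j) xi.

Let sample_meas i : measurable_fun setT (sample i).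
Proof. by rewrite /sample; case: i.2. Qed.

Let bad_meas xi j n : measurable (bad xi j n).
Proof. exact: measurable_deviates. Qed.

Let bad_weight xi : 0 < xi -> forall j, exists m : R, 0 <= m /\
  (\int[P]_x tail_weight R (bad xi j) x <= m%:E)%E.
Proof.
move=> xi0 j.
have inj : injective (fun k : nat => ((j.1, k), j.2)) by move=> k k' [].
have [s [r [s0 r01 hk]]] : exists s r : R, [/\ 0 < s, 0 <= r < 1 & forall k,
    (\int[P]_w (expR (s * (sample ((j.1, k), j.2) w - (center j + xi))))%:E <= r%:E)%E /\
    (\int[P]_w (expR (- s * (sample ((j.1, k), j.2) w - (center j - xi))))%:E <= r%:E)%E].
  case: j {inj} => a [].
    have [s [r [s0 r01 hZ]]] :=
      reward_tails h_ge0 h_meas M_nondegenerate P (mu_fam a) xi0.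
    exists s, r; split => // k; apply: hZ; first exact: X_meas.
    by move=> A mA; exact: X_law.
  have [s [r [s0 r01 hZ]]] := cost_tails ell_gt0 (kappa_supp a) P xi0.
  exists s, r; split => // k; apply: hZ; first exact: C_meas.
  by move=> A mA; exact: C_law.
have two0 : 0 <= 2 :> R by [].
suff hP n : (P (bad xi j n.+1) <= (2 * r ^+ n.+1)%:E)%E.
  have [m m0 hm] := integral_tail_weight (bad_meas xi j) two0 r01 hP.
  by exists m.
 rewrite mulrDl mul1r; apply: (deviates_le sample_meas XC_indep inj n s0 s0).
  by move=> k; exact: (proj1 (hk k)).
by move=> k; exact: (proj2 (hk k)).
Qed.

Let cost_ae : {ae P, forall om, forall a n, ell <= C a n om <= 1}.
Proof.
apply: filter_forall => a; apply: ae_foralln => n.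
exists (C a n @^-1` (~` `[ell, 1]%classic)); split.
- by apply: measurable_preimage => //; exact: measurableC.
- apply: etrans (C_law a n (measurableC (measurable_itv _))) _.
  by rewrite probability_setC // kappa_supp subee.
- by move=> om /= h1 h2; apply: h1; move: h2; rewrite in_itv.
Qed.

Lemma expected_cost_bound (r : R) : 0 < r -> r < V -> exists2 D, 0 <= D &
  forall delta, 0 < delta < 1 ->
  (\int[P]_om Jtau delta om <= (ln delta^-1 / r + D)%:E)%E.
Proof.
move=> r0 rV.
have bd := ef_bregman h_ge0 h_meas M_nondegenerate.
have [xi [D0 [xi0 D00 hJ]]] := J_tau_le bd K_ge2 mu_fam mu_a0 ell_gt0 cost_mean_ge
  wstar_max sel_in alpha_gt0 B_gt0 r0 rV.
have /choice[m hm] := bad_weight xi0.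
pose W om := (\sum_j tail_weight R (bad xi j) om)%E.
have W0 om : (0 <= W om)%E by apply: sume_ge0 => j _; exact: tail_weight_ge0.
have mW : measurable_fun setT W.
  by apply: emeasurable_sum => j; exact: measurable_tail_weight.
have intW : (\int[P]_om W om <= (\sum_j m j)%:E)%E.
  rewrite ge0_integral_sum //.
  - by rewrite -sumEFin; apply: lee_sum => j _; exact: (proj2 (hm j)).
  - by move=> j; exact: measurable_tail_weight.
  - by move=> j om _; exact: tail_weight_ge0.
(* Strict positivity makes [D1 * W] infinite where [W] is, so the pathwise bound holds there
   trivially. *)
pose D1 := D0 + 1; have D10 : 0 < D1 by rewrite /D1; lra.
have msum : 0 <= \sum_j m j by apply: sumr_ge0 => j _; exact: (proj1 (hm j)).
exists (D1 + D1 * \sum_j m j); first by rewrite addr_ge0 ?mulr_ge0 // ltW.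
move=> delta d01; have /andP[d0 d1] := d01.
have L0 : 0 <= ln delta^-1 / r.
  by rewrite divr_ge0 ?(ltW r0) // ln_ge0 // invf_ge1 // ltW.
pose k := ln delta^-1 / r + D1.
have k0 : 0 <= k by rewrite addr_ge0 // ltW.
pose f om := (k%:E + D1%:E * W om)%E.
have f0 om : (0 <= f om)%E.
  by rewrite adde_ge0 ?lee_fin // mule_ge0 // lee_fin ltW.
have mDW : measurable_fun setT (fun om => D1%:E * W om)%E by exact: measurable_funeM.
have mf : measurable_fun setT f by apply: emeasurable_funD.
have bound : {ae P, forall om, (Jtau delta om <= f om)%E}.
  apply: filterS cost_ae => om C_itv; rewrite /f /k.
  have := W0 om; case EW : (W om) => [y| |] // y0; last first.
    by rewrite gt0_muley ?lte_fin // addey ?leey.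
  rewrite -EFinM -EFinD.
  have [||n0 [n0_gt0 n0y good]] := @tail_time Omega R (fun n om => exists j, bad xi j n om) om y.
  - by rewrite -lee_fin.
  - move=> n [j bj]; rewrite -lee_fin -EW.
    have : (((n.+2 ^ 2)%:R)%:E <= tail_weight R (bad xi j) om)%E by exact: tail_weight_ge.
    move=> /le_trans; apply; rewrite /W (bigD1 j) //= leeDl //; apply: sume_ge0 => i _; exact: tail_weight_ge0.
  apply: le_trans (hJ _ _ _ om C_itv n0 n0_gt0 _ delta d01) _.
    move=> n nn a; split; rewrite ltNge; apply/negP => dev; apply: (good n nn).
      by exists (a, true).
    by exists (a, false).
  rewrite lee_fin -addrA lerD2l.
  apply: (@le_trans _ _ (D0 * (1 + y))); first by rewrite ler_wpM2l.
  rewrite /D1; move: y0; rewrite lee_fin => y0; lra.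
(* Costs are nonnegative only almost surely, so the comparison goes through the positive part. *)
rewrite integralE; apply: (@le_trans _ _ (\int[P]_om ((Jtau delta) ^\+ om))%E).
  by apply: geeDl; rewrite oppe_le0; apply: integral_ge0.
apply: (@le_trans _ _ (\int[P]_om f om)%E).
  apply: ae_ge0_le_integral => //; first exact: measurable_funepos.
  apply: filterS bound => om Jf _; rewrite funeposE ge_max Jf f0 //.
have PT : P setT = 1%E := probability_setT P.
have ik : (\int[P]_om k%:E = k%:E)%E.
  apply: etrans (integral_cst P measurableT k%:E) _.
  by apply: etrans (congr1 (fun z => k%:E * z)%E PT) _; rewrite mule1.
have D1E0 : (0 <= D1%:E)%E by rewrite lee_fin ltW.
have iW : (\int[P]_om (D1%:E * W om) = D1%:E * \int[P]_om W om)%E.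
  exact: (ge0_integralZl P measurableT mW (fun om _ => W0 om) D1E0).
have k0' (om : Omega) : setT om -> (0 <= k%:E)%E by move=> _; rewrite lee_fin.
have DW0 om : setT om -> (0 <= D1%:E * W om)%E by move=> _; exact: mule_ge0.
have mk : measurable_fun setT (fun _ : Omega => k%:E) by exact: measurable_cst.
rewrite (ge0_integralD P measurableT k0' mk DW0 mDW) ik iW.
have -> : ln delta^-1 / r + (D1 + D1 * \sum_j m j) = k + D1 * \sum_j m j.
  by rewrite /k addrA.
rewrite [leRHS]EFinD EFinM; apply: leeD => //; exact: lee_wpmul2l.
Qed.

End ExpectedCost.

(** * The limit of small error probability *)

Theorem theorem2 (R : realType) (K : nat) (hK : (2 <= K)%N)
  (* reward family: natural exponential family with base measure rho, carrier h *)
  (rho : {measure set (measurableTypeR R) -> \bar R}) (h : R -> R)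
  (h_ge0 : forall x, 0 <= h x) (h_meas : measurable_fun setT h)
  (* reward means of the arms *)
  (mu : 'I_K -> R)
  (mu_fam : forall a, ef_M rho h (mu a))
  (mu_01 : forall a, 0 <= mu a <= 1)
  (mu_best : exists a, is_best mu a)
  (* cost distributions, supported in [ell, 1] *)
  (kappa : 'I_K -> probability (measurableTypeR R) R) (ell : R) (ell_gt0 : 0 < ell)
  (kappa_supp : forall a, kappa a `[ell, 1]%classic = 1%E)
  (* probability space carrying the reward / cost stacks *)
  (dO : measure_display) (Omega : measurableType dO) (P : probability Omega R)
  (X C : 'I_K -> nat -> Omega -> R)
  (X_meas : forall a n, measurable_fun setT (X a n))
  (C_meas : forall a n, measurable_fun setT (C a n))
  (X_law : forall a n A, measurable A ->
     P (X a n @^-1` A) = ef_nu rho h (ef_theta rho h (mu a)) A)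
  (C_law : forall a n A, measurable A -> P (C a n @^-1` A) = kappa a A)
  (XC_indep : mutually_independent P
     (fun i : 'I_K * nat * bool => if i.2 then X i.1.1 i.1.2 else C i.1.1 i.1.2))
  (* the map (mu', c') |-> w*(mu', c') used by CTAS *)
  (wstar : ('I_K -> R) -> ('I_K -> R) -> ('I_K -> R))
  (wstar_max : forall mu' c' : 'I_K -> R, (exists a, is_best mu' a) -> (forall a, 0 < c' a) ->
     simplex (wstar mu' c') /\
     forall w, simplex w ->
       ctas_obj (ef_M rho h) (ef_d rho h) mu' c' w <=
       ctas_obj (ef_M rho h) (ef_d rho h) mu' c' (wstar mu' c'))
  (* tie-breaking rule for the argmin / argmax *)
  (sel : hist_t R K -> {set 'I_K} -> 'I_K)
  (sel_in : forall hs (S : {set 'I_K}), (0 < #|S|)%N -> sel hs S \in S)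
  (* threshold parameters *)
  (alpha B : R) (alpha_rng : 1 <= alpha <= expR 1 / 2) (B_gt0 : 0 < B)
  (Jtau_meas : forall delta, measurable_fun [set: Omega]
     (fun om => (J_tau (ef_d rho h) wstar sel X C B alpha delta om : \bar R))) :
  (limf_esup
     (fun delta : R =>
        (\int[P]_om J_tau (ef_d rho h) wstar sel X C B alpha delta om) *
        ((ln (delta^-1))^-1)%:E)
     (0^'+)
   <= (alpha * Tstar (ef_M rho h) (ef_d rho h) mu (cost_mean kappa))%:E)%E.
Proof.
have [a0 mu_a0] := mu_best.
have /andP[alpha1 _] := alpha_rng.
have alpha0 : 0 < alpha by lra.
pose c := cost_mean kappa.
have c_ge a : ell <= c a := cost_mean_ge ell_gt0 kappa_supp a.
have c_gt0 a : 0 < c a by exact: lt_le_trans (c_ge a).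
have bd := ef_bregman h_ge0 h_meas (M_nondegenerate hK mu_fam mu_a0).
have ws_max : is_maximizer (ef_M rho h) (ef_d rho h) mu c (wstar mu c).
  by apply: wstar_max => //; exists a0.
have V0 := maximum_gt0 bd hK mu_fam mu_a0 c_gt0 ws_max.
set V := ctas_obj _ _ mu c (wstar mu c) in V0.
have -> : Tstar (ef_M rho h) (ef_d rho h) mu (cost_mean kappa) = V^-1.
  have Vin : [set ctas_obj (ef_M rho h) (ef_d rho h) mu c w | w in @simplex R K] V.
    by exists (wstar mu c) => //; exact: (proj1 ws_max).
  have Vub : ubound [set ctas_obj (ef_M rho h) (ef_d rho h) mu c w | w in @simplex R K] V.
    by move=> _ [w sw <-]; exact: (proj2 ws_max).
  congr (_^-1); apply/eqP; rewrite eq_le; apply/andP; split.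
    by apply: ge_sup => //; exists V.
  by apply: ub_le_sup => //; exists V.
apply: (@le_trans _ _ (V^-1)%:E); last first.
  by rewrite lee_fin ler_peMl // invr_ge0 ltW.
apply/lee_addgt0Pr => e e0.
have Vi0 : 0 < V^-1 by rewrite invr_gt0.
(* Half of [e] is spent on the rate, as [1 / r = 1 / V + e / 2], and half on the constant [D], by
   restricting to [delta] in [U]. *)
pose r := (V^-1 + e / 2)^-1.
have r0 : 0 < r by rewrite invr_gt0; lra.
have rV : r < V by rewrite -[ltRHS]invrK ltf_pV2 ?posrE //; lra.
have [D D0 hD] := expected_cost_bound hK h_ge0 h_meas mu_fam mu_a0 ell_gt0 kappa_supp
  X_meas C_meas X_law C_law XC_indep wstar_max sel_in alpha0 B_gt0 Jtau_meas r0 rV.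
pose U := [set delta : R | 0 < delta < 1 /\ D * 2 / e < ln delta^-1].
have FU : (0 : R)^'+ U.
  pose t := Num.min (1 / 2) (expR (- (D * 2 / e + 1))).
  have t0 : 0 < t by rewrite lt_min expR_gt0 divr_gt0.
  have t1 : t < 1 by rewrite gt_min; apply/orP; left; lra.
  have : \forall delta \near (0 : R)^'+, delta < t by exact: nbhs_right_lt.
  have : \forall delta \near (0 : R)^'+, 0 < delta by exact: nbhs_right_gt.
  apply: filterS2 => delta d0 dt; split; first by rewrite d0 (lt_trans dt).
  rewrite lnV ?posrE // ltrNr -ltr_expR lnK ?posrE //.
  apply: (lt_le_trans dt); apply: (@le_trans _ _ (expR (- (D * 2 / e + 1)))).
    by rewrite ge_min lexx orbT.
  by rewrite ler_expR; lra.
(* The upper limit is an infimum of suprema over the sets of the filter, so the supremum over [U]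
   alone bounds it. *)
apply: ge_ereal_inf; eexists; first by exists U; [exact: FU|reflexivity].
apply: ge_ereal_sup => _ [delta [d01 dL] <-].
have L0 : 0 < ln delta^-1 by apply: le_lt_trans dL; rewrite !mulr_ge0 // invr_ge0 ltW.
apply: (@le_trans _ _ ((ln delta^-1 / r + D)%:E * ((ln delta^-1)^-1)%:E)%E).
  by rewrite lee_wpmul2r ?lee_fin ?invr_ge0 ?(ltW L0) //; exact: hD.
rewrite -EFinM -EFinD lee_fin mulrDl mulrAC divff ?gt_eqF // mul1r /r invrK -addrA lerD2l.
have : D / ln delta^-1 <= e / 2.
  by rewrite ler_pdivrMr // mulrC -ler_pdivrMr ?divr_gt0 // invf_div mulrA ltW.
lra.
Qed.
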